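(* For every HOL derivation $\mathcal{D}$ of a judgment $\Gamma\vdash\phi$, \[ \Sigma\mid\alpha_{1}:\mathsf{type},\ldots,\alpha_{n}:\mathsf{type},x_{1}:\|A_{1}\|,\ldots,x_{m}:\|A_{m}\|,\|\Gamma\|\vdash|\mathcal{D}|:\|\phi\| \] is derivable in the $\lambda\Pi$-calculus modulo rewriting, where $\alpha_{1},\ldots,\alpha_{n}$ are the free type variables and $x_{1}:A_{1},\ldots,x_{m}:A_{m}$ are the free term variables (with their HOL types) appearing in $\mathcal{D}$.
   Context: The $\lambda\Pi$-calculus modulo rewriting (the theory of Dedukti) has terms $x\mid c\mid \mathsf{Type}\mid\mathsf{Kind}\mid \Pi x:A.\,B\mid \lambda x:A.\,M\mid M\,N$ ($A\to B$ abbreviates $\Pi x:A.\,B$ with $x$ not free in $B$; $\Pi x,y:A.B$ abbreviates $\Pi x:A.\Pi y:A.B$). A signature $\Sigma$ is a list of constant declarations $c:A$ and rewrite rules $[\Gamma]\,M\leadsto N$; contexts are lists $x:A$. The judgment $\Sigma\mid\Gamma\vdash M:A$ is given by: variables and constants get their declared type (in a well-formed context); $\Gamma\vdash\mathsf{Type}:\mathsf{Kind}$; if $\Gamma\vdash A:\mathsf{Type}$ and $\Gamma,x:A\vdash B:s$ ($s\in\{\mathsf{Type},\mathsf{Kind}\}$) then $\Gamma\vdash\Pi x:A.B:s$; if $\Gamma\vdash A:\mathsf{Type}$ and $\Gamma,x:A\vdash M:B$ then $\Gamma\vdash\lambda x:A.M:\Pi x:A.B$; if $\Gamma\vdash M:\Pi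 x:A.B$ and $\Gamma\vdash N:A$ then $\Gamma\vdash M\,N:[N/x]B$; if $\Gamma\vdash M:A$, $\Gamma\vdash B:\mathsf{Type}$ and $A\equiv_{\beta\Sigma}B$ then $\Gamma\vdash M:B$, where $\equiv_{\beta\Sigma}$ is the congruence generated by $\beta$-reduction and the rewrite rules of $\Sigma$. Contexts are well formed when each declared type has type $\mathsf{Type}$. HOL: types $A::=\alpha\mid p(A_1,\ldots,A_n)$ ($\mathsf{bool},\mathsf{ind}$ are $0$-ary operators, $A\to B$ is $\to(A,B)$); terms are simply typed $\lambda$-terms $x\mid\lambda x:A.M\mid M\,N\mid c$ with polymorphic constants used at instances $c_{A_1,\ldots,A_n}$, including $(=_A):A\to A\to\mathsf{bool}$ (written infix) and $\mathsf{select}_A:(A\to\mathsf{bool})\to A$. Propositions are terms of type $\mathsf{bool}$; a HOL context $\Gamma$ is a finite set of propositions. HOL derivations are built with the rules: Refl: $\vdash M=M$; AbsThm: from $\Gamma\vdash M=N$ infer $\Gamma\vdash\lambda x:A.M=\lambda x:A.N$; AppThm: from $\Gamma\vdash F=G$ and $\Delta\vdash M=N$ infer $\Gamma\cup\Delta\vdash F\,M=G\,N$; Beta: $\vdash(\lambda x:A.M)\,x=M$; Assume: $\{\phi\}\vdash\phi$; EqMp: from $\Gamma\vdash\phi=\psi$ and $\Delta\vdash\phi$ infer $\Gamma\cup\Delta\vdash\psi$; DeductAntiSym: from $\Gamma\vdash\phi$ and $\Delta\vdash\psi$ infer $(\Gamma-\{\psi\})\cup(\Delta-\{\phi\})\vdash\phi=\psi$;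 Subst, split into TypeSubst (from $\Gamma\vdash\phi$ infer $\Gamma[\theta]\vdash\phi[\theta]$ for $\theta=A_1/\alpha_1,\ldots,A_k/\alpha_k$) and TermSubst (from $\Gamma\vdash\phi$ infer $\Gamma[\sigma]\vdash\phi[\sigma]$ for $\sigma=M_1/x_1,\ldots,M_k/x_k$ with $M_i$ of type $B_i$). $\Sigma$ contains: $\mathsf{type}:\mathsf{Type}$, $\mathsf{bool}:\mathsf{type}$, $\mathsf{ind}:\mathsf{type}$, $\mathsf{arrow}:\mathsf{type}\to\mathsf{type}\to\mathsf{type}$, and for each other $n$-ary type operator $p$ a constant $p:\mathsf{type}\to\cdots\to\mathsf{type}\to\mathsf{type}$; $\mathsf{term}:\mathsf{type}\to\mathsf{Type}$ with rewrite rule $[\alpha,\beta:\mathsf{type}]\ \mathsf{term}(\mathsf{arrow}\,\alpha\,\beta)\leadsto\mathsf{term}\,\alpha\to\mathsf{term}\,\beta$; $\mathsf{eq}:\Pi\alpha:\mathsf{type}.\,\mathsf{term}(\mathsf{arrow}\,\alpha(\mathsf{arrow}\,\alpha\,\mathsf{bool}))$; $\mathsf{select}:\Pi\alpha:\mathsf{type}.\,\mathsf{term}(\mathsf{arrow}(\mathsf{arrow}\,\alpha\,\mathsf{bool})\,\alpha)$; for each other HOL constant $c$ of type $A$ with free type variables $\alpha_1..\alpha_k$, $c:\Pi\alpha_1:\mathsf{type}\ldots\Pi\alpha_k:\mathsf{type}.\,\mathsf{term}|A|$; $\mathsf{proof}:\mathsf{term}\,\mathsf{bool}\to\mathsf{Type}$;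 $\mathsf{Refl}:\Pi\alpha:\mathsf{type}.\Pi x:\mathsf{term}\,\alpha.\,\mathsf{proof}(\mathsf{eq}\,\alpha\,x\,x)$; $\mathsf{FunExt}:\Pi\alpha,\beta:\mathsf{type}.\Pi f,g:\mathsf{term}(\mathsf{arrow}\,\alpha\,\beta).\,(\Pi x:\mathsf{term}\,\alpha.\,\mathsf{proof}(\mathsf{eq}\,\beta\,(f\,x)\,(g\,x)))\to\mathsf{proof}(\mathsf{eq}\,(\mathsf{arrow}\,\alpha\,\beta)\,f\,g)$; $\mathsf{AppThm}:\Pi\alpha,\beta:\mathsf{type}.\Pi f,g:\mathsf{term}(\mathsf{arrow}\,\alpha\,\beta).\Pi x,y:\mathsf{term}\,\alpha.\,\mathsf{proof}(\mathsf{eq}(\mathsf{arrow}\,\alpha\,\beta)\,f\,g)\to\mathsf{proof}(\mathsf{eq}\,\alpha\,x\,y)\to\mathsf{proof}(\mathsf{eq}\,\beta\,(f\,x)\,(g\,y))$; $\mathsf{PropExt}:\Pi p,q:\mathsf{term}\,\mathsf{bool}.\,(\mathsf{proof}\,q\to\mathsf{proof}\,p)\to(\mathsf{proof}\,p\to\mathsf{proof}\,q)\to\mathsf{proof}(\mathsf{eq}\,\mathsf{bool}\,p\,q)$; $\mathsf{EqMp}:\Pi p,q:\mathsf{term}\,\mathsf{bool}.\,\mathsf{proof}(\mathsf{eq}\,\mathsf{bool}\,p\,q)\to\mathsf{proof}\,p\to\mathsf{proof}\,q$. Translations: types $|\alpha|=\alpha$, $|\mathsf{bool}|=\mathsf{bool}$,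 $|\mathsf{ind}|=\mathsf{ind}$, $|A\to B|=\mathsf{arrow}|A||B|$, $|p(A_1..A_n)|=p|A_1|\cdots|A_n|$, $\|A\|=\mathsf{term}|A|$; terms $|x|=x$, $|M\,N|=|M|\,|N|$, $|\lambda x:A.M|=\lambda x:\|A\|.|M|$, $|(=_A)|=\mathsf{eq}|A|$, $|\mathsf{select}_A|=\mathsf{select}|A|$, $|c_{A_1..A_n}|=c|A_1|\cdots|A_n|$; for a proposition $\|\phi\|=\mathsf{proof}\,|\phi|$; for $\Gamma=\{\phi_1,\ldots,\phi_k\}$, $\|\Gamma\|=h_{\phi_1}:\|\phi_1\|,\ldots,h_{\phi_k}:\|\phi_k\|$ with fresh variables $h_{\phi_i}$. Derivations (by last rule; $\mathcal{D}_i$ the premises): Refl on $M:A$ gives $\mathsf{Refl}|A||M|$; AbsThm with $M,N:B$ gives $\mathsf{FunExt}|A||B|\,|\lambda x:A.M|\,|\lambda x:A.N|\,(\lambda x:\|A\|.|\mathcal{D}|)$; AppThm with $F,G:A\to B$ gives $\mathsf{AppThm}|A||B||F||G||M||N||\mathcal{D}_1||\mathcal{D}_2|$; Beta with $M:B$ gives $\mathsf{Refl}|B||M|$; Assume gives $h_\phi$; DeductAntiSym gives $\mathsf{PropExt}|\phi||\psi|(\lambda h_\psi:\|\psi\|.|\mathcal{D}_1|)(\lambda h_\phi:\|\phi\|.|\mathcal{D}_2|)$; EqMp gives $\mathsf{EqMp}|\phi||\psi||\mathcal{D}_1||\mathcal{D}_2|$; TypeSubst gives $(\lambda\alpha_1:\mathsf{type}\ldots\lambda\alpha_k:\mathsf{type}.|\mathcal{D}|)|A_1|\cdots|A_k|$;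 TermSubst gives $(\lambda x_1:\|B_1\|\ldots\lambda x_k:\|B_k\|.|\mathcal{D}|)|M_1|\cdots|M_k|$.
   Formalization: AbsThm requires x:A not free in Γ; |D| for TypeSubst/TermSubst also abstracts the term variables and hypotheses whose types mention a substituted variable and applies them to their instances (the literal clause is ill-typed, e.g. Refl on x:α followed by bool/α). *)

(* Defs.v *)
From HB Require Import structures.
From mathcomp Require Import all_boot finmap.
From Stdlib Require List.

Set Implicit Arguments.
Unset Strict Implicit.
Unset Printing Implicit Defensive.

Local Open Scope fset_scope.

(** Terms of the lambda-Pi-calculus modulo rewriting. Variables are de Bruijn
    indices; [C] is the set of constant names. *)

Inductive sort := sType | sKind.

Inductive term (C : Type) :=
| Var (n : nat)
| Cst (c : C)
| Sort (s : sort)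
| Pi (A B : term C)
| Lam (A M : term C)
| App (M N : term C).

Arguments Var {C} n.
Arguments Cst {C} c.
Arguments Sort {C} s.

Definition up_ren (xi : nat -> nat) (n : nat) : nat :=
  if n is m.+1 then (xi m).+1 else 0.

Fixpoint rename C (xi : nat -> nat) (t : term C) : term C :=
  match t with
  | Var n => Var (xi n)
  | Cst c => Cst c
  | Sort s => Sort s
  | Pi A B => Pi (rename xi A) (rename (up_ren xi) B)
  | Lam A M => Lam (rename xi A) (rename (up_ren xi) M)
  | App M N => App (rename xi M) (rename xi N)
  end.

Definition shift C (k : nat) (t : term C) : term C := rename (addn k) t.

Definition up C (sigma : nat -> term C) (n : nat) : term C :=
  if n is m.+1 then shift 1 (sigma m) else Var 0.

Fixpoint subst C (sigma : nat -> term C) (t : term C) : term C :=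
  match t with
  | Var n => sigma n
  | Cst c => Cst c
  | Sort s => Sort s
  | Pi A B => Pi (subst sigma A) (subst (up sigma) B)
  | Lam A M => Lam (subst sigma A) (subst (up sigma) M)
  | App M N => App (subst sigma M) (subst sigma N)
  end.

(** [inst N B] is [[N/x]B] for the variable [x] of index 0. *)
Definition inst C (N B : term C) : term C :=
  subst (fun n => if n is m.+1 then Var m else N) B.

Definition arr C (A B : term C) : term C := Pi A (shift 1 B).
Definition apps C (M : term C) (Ns : seq (term C)) : term C := foldl (@App C) M Ns.

(** In contexts the most recently declared variable comes first, so the [n]-th
    type lives in the scope of the entries that follow it. *)
Definition context C := seq (term C).

Inductive sig_entry (C : Type) :=
| Decl (c : C) (A : term C)
| Rule (G : context C) (M N : term C).

Definition signature C := seq (sig_entry C).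

Inductive conv C (Sg : signature C) : term C -> term C -> Prop :=
| conv_beta A M N : conv Sg (App (Lam A M) N) (inst N M)
| conv_rule G M N (sigma : nat -> term C) :
    List.In (Rule G M N) Sg -> conv Sg (subst sigma M) (subst sigma N)
| conv_refl M : conv Sg M M
| conv_sym M N : conv Sg M N -> conv Sg N M
| conv_trans M N P : conv Sg M N -> conv Sg N P -> conv Sg M P
| conv_pi A A' B B' : conv Sg A A' -> conv Sg B B' -> conv Sg (Pi A B) (Pi A' B')
| conv_lam A A' M M' : conv Sg A A' -> conv Sg M M' -> conv Sg (Lam A M) (Lam A' M')
| conv_app M M' N N' : conv Sg M M' -> conv Sg N N' -> conv Sg (App M N) (App M' N').

Inductive wf_ctx C (Sg : signature C) : context C -> Prop :=
| wf_nil : wf_ctx Sg [::]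
| wf_cons G A : wf_ctx Sg G -> typing Sg G A (Sort sType) -> wf_ctx Sg (A :: G)

with typing C (Sg : signature C) : context C -> term C -> term C -> Prop :=
| typing_var G n A :
    wf_ctx Sg G -> onth G n = Some A -> typing Sg G (Var n) (shift n.+1 A)
| typing_cst G c A :
    (* no shift of [A]: declared types are closed *)
    wf_ctx Sg G -> List.In (Decl c A) Sg -> typing Sg G (Cst c) A
| typing_type G :
    wf_ctx Sg G -> typing Sg G (Sort sType) (Sort sKind)
| typing_pi G A B s :
    typing Sg G A (Sort sType) -> typing Sg (A :: G) B (Sort s) ->
    typing Sg G (Pi A B) (Sort s)
| typing_lam G A M B :
    typing Sg G A (Sort sType) -> typing Sg (A :: G) M B ->
    typing Sg G (Lam A M) (Pi A B)
| typing_app G M N A B :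
    typing Sg G M (Pi A B) -> typing Sg G N A ->
    typing Sg G (App M N) (inst N B)
| typing_conv G M A B :
    typing Sg G M A -> typing Sg G B (Sort sType) -> conv Sg A B ->
    typing Sg G M B.

Inductive hop := OpBool | OpInd | OpArrow | OpOther (i : nat).

Inductive hty :=
| TVar (a : nat)
| TOp (p : hop) (As : seq hty).

Definition tbool : hty := TOp OpBool [::].
Definition tarrow (A B : hty) : hty := TOp OpArrow [:: A; B].

Inductive hcst := CstEq | CstSelect | CstOther (j : nat).

(** Terms up to alpha-equivalence: bound variables are de Bruijn indices, a free
    variable is a name together with its type. *)
Inductive hterm :=
| HBound (n : nat)
| HFree (x : nat) (A : hty)
| HLam (A : hty) (M : hterm)
| HApp (M N : hterm)
| HCst (c : hcst) (As : seq hty).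

Definition hop_enc (p : hop) : nat :=
  match p with OpBool => 0 | OpInd => 1 | OpArrow => 2 | OpOther i => i.+3 end.
Definition hop_dec (n : nat) : hop :=
  match n with 0 => OpBool | 1 => OpInd | 2 => OpArrow | i.+3 => OpOther i end.
Lemma hop_encK : cancel hop_enc hop_dec. Proof. by case. Qed.
HB.instance Definition _ := Countable.copy hop (can_type hop_encK).

Definition hcst_enc (c : hcst) : nat :=
  match c with CstEq => 0 | CstSelect => 1 | CstOther j => j.+2 end.
Definition hcst_dec (n : nat) : hcst :=
  match n with 0 => CstEq | 1 => CstSelect | j.+2 => CstOther j end.
Lemma hcst_encK : cancel hcst_enc hcst_dec. Proof. by case. Qed.
HB.instance Definition _ := Countable.copy hcst (can_type hcst_encK).

Fixpoint hty_enc (A : hty) : GenTree.tree nat :=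
  match A with
  | TVar a => GenTree.Leaf a
  | TOp p As => GenTree.Node (hop_enc p) (map hty_enc As)
  end.
Fixpoint hty_dec (t : GenTree.tree nat) : hty :=
  match t with
  | GenTree.Leaf a => TVar a
  | GenTree.Node n ts => TOp (hop_dec n) (map hty_dec ts)
  end.
Lemma hty_encK : cancel hty_enc hty_dec.
Proof.
rewrite /cancel; fix IH 1; case=> [a|p As] //=; rewrite hop_encK; congr TOp.
by elim: As => //= A As ->; rewrite IH.
Qed.
HB.instance Definition _ := Countable.copy hty (can_type hty_encK).

Definition hterm_leaf : Type := (nat + nat * hty + hty + hcst * seq hty)%type.
Fixpoint hterm_enc (M : hterm) : GenTree.tree hterm_leaf :=
  match M with
  | HBound n => GenTree.Leaf (inl (inl (inl n)))
  | HFree x A => GenTree.Leaf (inl (inl (inr (x, A))))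
  | HLam A M => GenTree.Node 0 [:: GenTree.Leaf (inl (inr A)); hterm_enc M]
  | HApp M N => GenTree.Node 1 [:: hterm_enc M; hterm_enc N]
  | HCst c As => GenTree.Leaf (inr (c, As))
  end.
Fixpoint hterm_dec (t : GenTree.tree hterm_leaf) : option hterm :=
  match t with
  | GenTree.Leaf (inl (inl (inl n))) => Some (HBound n)
  | GenTree.Leaf (inl (inl (inr (x, A)))) => Some (HFree x A)
  | GenTree.Leaf (inr (c, As)) => Some (HCst c As)
  | GenTree.Node 0 [:: GenTree.Leaf (inl (inr A)); t] => omap (HLam A) (hterm_dec t)
  | GenTree.Node 1 [:: t; u] =>
      if (hterm_dec t, hterm_dec u) is (Some M, Some N) then Some (HApp M N) else None
  | _ => None
  end.
Lemma hterm_encK : pcancel hterm_enc hterm_dec.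
Proof. by elim=> //= [A M -> | M -> N ->]. Qed.
HB.instance Definition _ := Countable.copy hterm (pcan_type hterm_encK).

(** The type operators and constants other than the built-in ones: [hs_ops] lists
    the arities of the operators [OpOther i], [hs_csts] the types of the
    constants [CstOther j]. *)
Record hsig := HSig { hs_ops : seq nat; hs_csts : seq hty }.

Definition hop_arity (S : hsig) (p : hop) : option nat :=
  match p with
  | OpBool | OpInd => Some 0
  | OpArrow => Some 2
  | OpOther i => onth (hs_ops S) i
  end.

Fixpoint wf_hty (S : hsig) (A : hty) : bool :=
  match A with
  | TVar _ => true
  | TOp p As => (hop_arity S p == Some (size As)) && all (wf_hty S) As
  end.

Definition wf_hsig (S : hsig) : bool := all (wf_hty S) (hs_csts S).

Fixpoint ftv_ty (A : hty) : seq nat :=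
  match A with
  | TVar a => [:: a]
  | TOp _ As => flatten (map ftv_ty As)
  end.

Definition tysubst := seq (nat * hty).

Fixpoint subst_ty (theta : tysubst) (A : hty) : hty :=
  match A with
  | TVar a => if a \in unzip1 theta then nth (TVar a) (unzip2 theta) (index a (unzip1 theta))
              else TVar a
  | TOp p As => TOp p (map (subst_ty theta) As)
  end.

Definition hcst_ty (S : hsig) (c : hcst) : option hty :=
  match c with
  | CstEq => Some (tarrow (TVar 0) (tarrow (TVar 0) tbool))
  | CstSelect => Some (tarrow (tarrow (TVar 0) tbool) (TVar 0))
  | CstOther j => onth (hs_csts S) j
  end.

(** The type parameters of a constant of type [A], in a fixed order. *)
Definition ty_params (A : hty) : seq nat := undup (ftv_ty A).

(** [D] lists the types of the bound variables in scope. *)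
Inductive htyping (S : hsig) : seq hty -> hterm -> hty -> Prop :=
| ht_bound D n A : onth D n = Some A -> htyping S D (HBound n) A
| ht_free D x A : wf_hty S A -> htyping S D (HFree x A) A
| ht_lam D A M B :
    wf_hty S A -> htyping S (A :: D) M B -> htyping S D (HLam A M) (tarrow A B)
| ht_app D M N A B :
    htyping S D M (tarrow A B) -> htyping S D N A -> htyping S D (HApp M N) B
| ht_cst D c A As :
    hcst_ty S c = Some A -> size As = size (ty_params A) -> all (wf_hty S) As ->
    htyping S D (HCst c As) (subst_ty (zip (ty_params A) As) A).

Definition heq (A : hty) (M N : hterm) : hterm := HApp (HApp (HCst CstEq [:: A]) M) N.

Fixpoint ftv (M : hterm) : seq nat :=
  match M with
  | HBound _ => [::]
  | HFree _ A => ftv_ty A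
  | HLam A M => ftv_ty A ++ ftv M
  | HApp M N => ftv M ++ ftv N
  | HCst _ As => flatten (map ftv_ty As)
  end.

Definition hvar : Type := (nat * hty)%type.

Fixpoint fv (M : hterm) : seq hvar :=
  match M with
  | HBound _ | HCst _ _ => [::]
  | HFree x A => [:: (x, A)]
  | HLam _ M => fv M
  | HApp M N => fv M ++ fv N
  end.

Fixpoint close (k : nat) (v : hvar) (M : hterm) : hterm :=
  match M with
  | HBound n => HBound n
  | HFree x A => if (x, A) == v then HBound k else HFree x A
  | HLam A M => HLam A (close k.+1 v M)
  | HApp M N => HApp (close k v M) (close k v N)
  | HCst c As => HCst c As
  end.

(** [habs x A M] is [lambda x : A. M], binding the free variable [x : A] of [M]. *)
Definition habs (x : nat) (A : hty) (M : hterm) : hterm := HLam A (close 0 (x, A) M).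

Fixpoint tsubst (theta : tysubst) (M : hterm) : hterm :=
  match M with
  | HBound n => HBound n
  | HFree x A => HFree x (subst_ty theta A)
  | HLam A M => HLam (subst_ty theta A) (tsubst theta M)
  | HApp M N => HApp (tsubst theta M) (tsubst theta N)
  | HCst c As => HCst c (map (subst_ty theta) As)
  end.

Definition tmsubst := seq (hvar * hterm).

(** No lifting is needed: the terms substituted in derivations have no dangling
    bound variable. *)
Fixpoint vsubst (sigma : tmsubst) (M : hterm) : hterm :=
  match M with
  | HBound n => HBound n
  | HFree x A => if (x, A) \in unzip1 sigma
                 then nth (HFree x A) (unzip2 sigma) (index (x, A) (unzip1 sigma))
                 else HFree x A
  | HLam A M => HLam A (vsubst sigma M)
  | HApp M N => HApp (vsubst sigma M) (vsubst sigma N)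
  | HCst c As => HCst c As
  end.

Inductive deriv (S : hsig) : {fset hterm} -> hterm -> Type :=
| DRefl M A :
    htyping S [::] M A -> deriv S fset0 (heq A M M)
| DAbsThm G x A B M N :
    wf_hty S A -> (forall phi, phi \in G -> (x, A) \notin fv phi) ->
    deriv S G (heq B M N) ->
    deriv S G (heq (tarrow A B) (habs x A M) (habs x A N))
| DAppThm G D A B F F' M N :
    deriv S G (heq (tarrow A B) F F') -> deriv S D (heq A M N) ->
    deriv S (G `|` D) (heq B (HApp F M) (HApp F' N))
| DBeta x A M B :
    wf_hty S A -> htyping S [::] M B ->
    deriv S fset0 (heq B (HApp (habs x A M) (HFree x A)) M)
| DAssume phi :
    htyping S [::] phi tbool -> deriv S [fset phi] phi
| DEqMp G D phi psi :
    deriv S G (heq tbool phi psi) -> deriv S D phi -> deriv S (G `|` D) psi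
| DDeductAntiSym G D phi psi :
    deriv S G phi -> deriv S D psi ->
    deriv S ((G `\ psi) `|` (D `\ phi)) (heq tbool phi psi)
| DTypeSubst G phi (theta : tysubst) :
    uniq (unzip1 theta) -> all (wf_hty S) (unzip2 theta) ->
    deriv S G phi ->
    deriv S [fset tsubst theta psi | psi in G] (tsubst theta phi)
| DTermSubst G phi (sigma : tmsubst) :
    uniq (unzip1 sigma) ->
    (forall x B M, ((x, B), M) \in sigma -> htyping S [::] M B) ->
    deriv S G phi ->
    deriv S [fset vsubst sigma psi | psi in G] (vsubst sigma phi).

(** [DAbsThm] binds its variable [x : A]; [DTypeSubst] and [DTermSubst] bind the
    variables they substitute, and under [DTypeSubst] a free [x : A] of the premise
    becomes [x : A[theta]]. *)
Fixpoint deriv_ftv S G phi (d : deriv S G phi) : seq nat :=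
  match d with
  | DRefl M A _ => ftv M
  | DAbsThm _ x A _ _ _ _ _ d => ftv_ty A ++ deriv_ftv d
  | DAppThm _ _ _ _ _ _ _ _ d1 d2 => deriv_ftv d1 ++ deriv_ftv d2
  | DBeta x A M _ _ _ => ftv_ty A ++ ftv M
  | DAssume phi _ => ftv phi
  | DEqMp _ _ _ _ d1 d2 => deriv_ftv d1 ++ deriv_ftv d2
  | DDeductAntiSym _ _ _ _ d1 d2 => deriv_ftv d1 ++ deriv_ftv d2
  | DTypeSubst _ _ theta _ _ d =>
      [seq a <- deriv_ftv d | a \notin unzip1 theta] ++ flatten (map ftv_ty (unzip2 theta))
  | DTermSubst _ _ sigma _ _ d =>
      deriv_ftv d ++ flatten [seq ftv_ty v.2 | v <- unzip1 sigma]
                  ++ flatten (map ftv (unzip2 sigma))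
  end.

Fixpoint deriv_fv S G phi (d : deriv S G phi) : seq hvar :=
  match d with
  | DRefl M A _ => fv M
  | DAbsThm _ x A _ _ _ _ _ d => [seq v <- deriv_fv d | v != (x, A)]
  | DAppThm _ _ _ _ _ _ _ _ d1 d2 => deriv_fv d1 ++ deriv_fv d2
  | DBeta x A M _ _ _ => (x, A) :: fv M
  | DAssume phi _ => fv phi
  | DEqMp _ _ _ _ d1 d2 => deriv_fv d1 ++ deriv_fv d2
  | DDeductAntiSym _ _ _ _ d1 d2 => deriv_fv d1 ++ deriv_fv d2
  | DTypeSubst _ _ theta _ _ d => [seq (v.1, subst_ty theta v.2) | v <- deriv_fv d]
  | DTermSubst _ _ sigma _ _ d =>
      [seq v <- deriv_fv d | v \notin unzip1 sigma] ++ flatten (map fv (unzip2 sigma))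
  end.

Inductive dkcst :=
| Ctype
| Cop (p : hop)
| Cterm
| Chol (c : hcst)
| Cproof
| CRefl | CFunExt | CAppThm | CPropExt | CEqMp.

Notation dkterm := (term dkcst).

Definition dtype : dkterm := Cst Ctype.
Definition dbool : dkterm := Cst (Cop OpBool).
Definition darrow (A B : dkterm) : dkterm := App (App (Cst (Cop OpArrow)) A) B.
Definition dterm (A : dkterm) : dkterm := App (Cst Cterm) A.
Definition deq (A M N : dkterm) : dkterm := apps (Cst (Chol CstEq)) [:: A; M; N].
Definition dproof (P : dkterm) : dkterm := App (Cst Cproof) P.

(** Names of the lambda-Pi variables: [alpha], [x : A], and [h_phi]. *)
Inductive dkvar :=
| VTy (a : nat)
| VTm (v : hvar)
| VHyp (phi : hterm).

Definition dkvar_enc (v : dkvar) : nat + hvar + hterm :=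
  match v with VTy a => inl (inl a) | VTm v => inl (inr v) | VHyp phi => inr phi end.
Definition dkvar_dec (s : nat + hvar + hterm) : dkvar :=
  match s with inl (inl a) => VTy a | inl (inr v) => VTm v | inr phi => VHyp phi end.
Lemma dkvar_encK : cancel dkvar_enc dkvar_dec. Proof. by case. Qed.
HB.instance Definition _ := Countable.copy dkvar (can_type dkvar_encK).

(** An environment gives the de Bruijn term standing for each named variable;
    [bind v e] is the environment under a binder named [v], [weaken e] the one
    under a binder with no name. *)
Definition env := dkvar -> dkterm.
Definition weaken (e : env) : env := fun w => shift 1 (e w).
Definition bind (v : dkvar) (e : env) : env :=
  fun w => if w == v then Var 0 else shift 1 (e w).

(** Undeclared names are sent to [Kind], which has no type. *)
Definition env0 : env := fun _ => Sort sKind.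

Fixpoint tr_ty (e : env) (A : hty) : dkterm :=
  match A with
  | TVar a => e (VTy a)
  | TOp p As => apps (Cst (Cop p)) (map (tr_ty e) As)
  end.

Fixpoint tr_tm (e : env) (M : hterm) : dkterm :=
  match M with
  | HBound n => Var n
  | HFree x A => e (VTm (x, A))
  | HLam A M => Lam (dterm (tr_ty e A)) (tr_tm (weaken e) M)
  | HApp M N => App (tr_tm e M) (tr_tm e N)
  | HCst c As => apps (Cst (Chol c)) (map (tr_ty e) As)
  end.

Definition tr_prop (e : env) (phi : hterm) : dkterm := dproof (tr_tm e phi).

Definition var_ty (e : env) (v : dkvar) : dkterm :=
  match v with
  | VTy _ => dtype
  | VTm (_, A) => dterm (tr_ty e A)
  | VHyp phi => tr_prop e phi
  end.

Fixpoint pis (vs : seq dkvar) (e : env) (body : env -> dkterm) : dkterm :=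
  if vs is v :: vs' then Pi (var_ty e v) (pis vs' (bind v e) body) else body e.

Fixpoint lams (vs : seq dkvar) (e : env) (body : env -> dkterm) : dkterm :=
  if vs is v :: vs' then Lam (var_ty e v) (lams vs' (bind v e) body) else body e.

(** The context declaring [vs] from left to right, and its environment. *)
Definition env_of (vs : seq dkvar) : env := foldl (fun e v => bind v e) env0 vs.
Definition ctx_of (vs : seq dkvar) : context dkcst :=
  (foldl (fun Ge v => (var_ty Ge.2 v :: Ge.1, bind v Ge.2)) ([::], env0) vs).1.

(** The translations of the two substitution rules are
      [(lambda alphas. |d|) |A_1| ... |A_k|] and [(lambda xs. |d|) |M_1| ... |M_k|],
    where in addition the variables of [|d|] whose type depends on a substituted
    variable are abstracted right after it and applied to their instances: in
    [lambda alpha. |d|] a free [x : A] or [h_phi] of [|d|] with [alpha] free in [A]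
    or [phi] cannot stay free, since its type mentions the bound [alpha], while
    the conclusion of the rule has [x : A[theta]] and [h_(phi[theta])] instead.
    When there is no such variable, the displayed terms are exactly the
    translations. *)

Definition ty_dep_vars (theta : tysubst) (vs : seq hvar) : seq hvar :=
  [seq v <- undup vs | has (mem (unzip1 theta)) (ftv_ty v.2)].
Definition ty_dep_hyps (theta : tysubst) (G : {fset hterm}) : seq hterm :=
  [seq psi <- enum_fset G | has (mem (unzip1 theta)) (ftv psi)].
Definition tm_dep_hyps (sigma : tmsubst) (G : {fset hterm}) : seq hterm :=
  [seq psi <- enum_fset G | has (mem (unzip1 sigma)) (fv psi)].

Fixpoint tr_deriv S G phi (d : deriv S G phi) (e : env) : dkterm :=
  match d with
  | DRefl M A _ => apps (Cst CRefl) [:: tr_ty e A; tr_tm e M]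
  | DAbsThm _ x A B M N _ _ d =>
      apps (Cst CFunExt)
        [:: tr_ty e A; tr_ty e B; tr_tm e (habs x A M); tr_tm e (habs x A N);
            Lam (dterm (tr_ty e A)) (tr_deriv d (bind (VTm (x, A)) e))]
  | DAppThm _ _ A B F F' M N d1 d2 =>
      apps (Cst CAppThm)
        [:: tr_ty e A; tr_ty e B; tr_tm e F; tr_tm e F'; tr_tm e M; tr_tm e N;
            tr_deriv d1 e; tr_deriv d2 e]
  | DBeta x A M B _ _ => apps (Cst CRefl) [:: tr_ty e B; tr_tm e M]
  | DAssume phi _ => e (VHyp phi)
  | DEqMp _ _ phi psi d1 d2 =>
      apps (Cst CEqMp) [:: tr_tm e phi; tr_tm e psi; tr_deriv d1 e; tr_deriv d2 e]
  | DDeductAntiSym _ _ phi psi d1 d2 =>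
      apps (Cst CPropExt)
        [:: tr_tm e phi; tr_tm e psi;
            Lam (tr_prop e psi) (tr_deriv d1 (bind (VHyp psi) e));
            Lam (tr_prop e phi) (tr_deriv d2 (bind (VHyp phi) e))]
  | DTypeSubst G _ theta _ _ d =>
      let xs := ty_dep_vars theta (deriv_fv d) in
      let hs := ty_dep_hyps theta G in
      apps (lams (map VTy (unzip1 theta) ++ map VTm xs ++ map VHyp hs) e
              (fun e' => tr_deriv d e'))
        (map (tr_ty e) (unzip2 theta)
         ++ [seq e (VTm (v.1, subst_ty theta v.2)) | v <- xs]
         ++ [seq e (VHyp (tsubst theta psi)) | psi <- hs])
  | DTermSubst G _ sigma _ _ d =>
      let hs := tm_dep_hyps sigma G in
      apps (lams (map VTm (unzip1 sigma) ++ map VHyp hs) e (fun e' => tr_deriv d e'))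
        (map (tr_tm e) (unzip2 sigma)
         ++ [seq e (VHyp (vsubst sigma psi)) | psi <- hs])
  end.

Local Notation "# n" := (Var n) (at level 9, format "# n").

Definition op_decls (S : hsig) : signature dkcst :=
  [seq Decl (Cop (OpOther i)) (iter (nth 0 (hs_ops S) i) (arr dtype) dtype)
     | i <- iota 0 (size (hs_ops S))].

Definition cst_ty (A : hty) : dkterm :=
  pis (map VTy (ty_params A)) env0 (fun e => dterm (tr_ty e A)).

Definition cst_decls (S : hsig) : signature dkcst :=
  [seq Decl (Chol (CstOther j)) (cst_ty (nth tbool (hs_csts S) j))
     | j <- iota 0 (size (hs_csts S))].

Definition Sigma (S : hsig) : signature dkcst :=
  [:: Decl Ctype (Sort sType);
      Decl (Cop OpBool) dtype;
      Decl (Cop OpInd) dtype;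
      Decl (Cop OpArrow) (arr dtype (arr dtype dtype))]
  ++ op_decls S ++
  [:: Decl Cterm (arr dtype (Sort sType));
      (* [alpha, beta] term (arrow alpha beta) ~> term alpha -> term beta *)
      Rule [:: dtype; dtype] (dterm (darrow #1 #0)) (arr (dterm #1) (dterm #0));
      Decl (Chol CstEq) (Pi dtype (dterm (darrow #0 (darrow #0 dbool))));
      Decl (Chol CstSelect) (Pi dtype (dterm (darrow (darrow #0 dbool) #0)))]
  ++ cst_decls S ++
  [:: Decl Cproof (arr (dterm dbool) (Sort sType));
      (* the comments list the variables bound by the outer products *)
      (* alpha x *)
      Decl CRefl (Pi dtype (Pi (dterm #0) (dproof (deq #1 #0 #0))));
      (* alpha beta f g *)
      Decl CFunExt
        (Pi dtype (Pi dtype (Pi (dterm (darrow #1 #0)) (Pi (dterm (darrow #2 #1))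
           (arr (Pi (dterm #3) (dproof (deq #3 (App #2 #0) (App #1 #0))))
                (dproof (deq (darrow #3 #2) #1 #0)))))));
      (* alpha beta f g x y *)
      Decl CAppThm
        (Pi dtype (Pi dtype (Pi (dterm (darrow #1 #0)) (Pi (dterm (darrow #2 #1))
           (Pi (dterm #3) (Pi (dterm #4)
              (arr (dproof (deq (darrow #5 #4) #3 #2))
                 (arr (dproof (deq #5 #1 #0))
                      (dproof (deq #4 (App #3 #1) (App #2 #0)))))))))));
      (* p q *)
      Decl CPropExt
        (Pi (dterm dbool) (Pi (dterm dbool)
           (arr (arr (dproof #0) (dproof #1))
              (arr (arr (dproof #1) (dproof #0))
                   (dproof (deq dbool #1 #0))))));
      (* p q *)
      Decl CEqMp
        (Pi (dterm dbool) (Pi (dterm dbool)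
           (arr (dproof (deq dbool #1 #0)) (arr (dproof #1) (dproof #0)))))].

(* Main.v *)
Require Import Defs.
From mathcomp Require Import all_boot finmap.

(** Call a name [v] good in a context [G] under an environment [e] when the term [e v]
    standing for it has in [G] the translated type of [v]. Goodness of the type
    variables, term variables and hypotheses of a derivation [d] is enough for the
    translation of [d] to have the translated type of its conclusion, whatever [G] and
    [e] are otherwise; stated in this form, the claim goes by induction on [d]. A binder
    adds a good name and spoils only the names whose types depend on it: for AbsThm
    these are excluded by the side condition, and for the substitution rules they are
    exactly the ones abstracted again. An abstracted translation applied to arguments
    has the type obtained by updating the environment, and translating in the updated
    environment is the same as translating the substituted formula. *)

Set Implicit Arguments.
Unset Strict Implicit.
Unset Printing Implicit Defensive.

Local Open Scope fset_scope.

(** * Substitution and weakening in the lambda-Pi calculus *)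


(** The translation of a substitution rule is a redex that stays unreduced, so its typing rests on
    [typing_app]: no substitution lemma for typing, no subject reduction and no confluence enters,
    and weakening is the only structural property used. The obstacle is dependency: rebinding
    [alpha] changes the translated type of every [x : A] and [h_phi] that mentions [alpha], and the
    old declaration no longer fits it. Hence [deps] tracks what the type of each name mentions, and
    every rebinding asks that the surviving names do not depend on what is rebound. Environments
    send names to arbitrary terms rather than variables, so that the same translation describes a
    formula under the abstractions and after the arguments have been supplied. Conversion enters for
    three reasons only: the rewrite rule on function types, the eta-like mismatch between AbsThm and
    [FunExt], and Beta. *)

Section Calculus.
Variable C : Type.
Implicit Types (t M N A B : term C) (xi zeta : nat -> nat) (s r : nat -> term C).

Definition scons N s (n : nat) : term C := if n is m.+1 then s m else N.

Lemma subst_ext s r t : s =1 r -> subst s t = subst r t.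
Proof.
elim: t s r => //= [A IHA B IHB|A IHA M IHM|M IHM N IHN] s r E.
- by rewrite (IHA _ _ E) (IHB _ (up r)) // => -[|n] //=; rewrite E.
- by rewrite (IHA _ _ E) (IHM _ (up r)) // => -[|n] //=; rewrite E.
- by rewrite (IHM _ _ E) (IHN _ _ E).
Qed.

Lemma subst_Var t : subst Var t = t.
Proof.
have upV : up (@Var C) =1 Var by case.
elim: t => //= [A -> B IHB|A -> M IHM|M -> N -> //].
- by rewrite (subst_ext _ upV) IHB.
- by rewrite (subst_ext _ upV) IHM.
Qed.

(** The fusion laws for renamings and substitutions must come in this order, since the binder case
    of [rename_subst] needs fusion of renamings, and that of [subst_subst] needs both mixed laws. *)
Lemma subst_rename s xi t : subst s (rename xi t) = subst (s \o xi) t.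
Proof.
elim: t s xi => //= [A IHA B IHB|A IHA M IHM|M IHM N IHN] s xi.
- by rewrite IHA IHB; congr Pi; apply: subst_ext; case.
- by rewrite IHA IHM; congr Lam; apply: subst_ext; case.
- by rewrite IHM IHN.
Qed.

Lemma rename_subst_Var xi t : rename xi t = subst (Var \o xi) t.
Proof.
elim: t xi => //= [A IHA B IHB|A IHA M IHM|M IHM N IHN] xi.
- by rewrite IHA IHB; congr Pi; apply: subst_ext; case.
- by rewrite IHA IHM; congr Lam; apply: subst_ext; case.
- by rewrite IHM IHN.
Qed.

Lemma rename_rename xi zeta t : rename xi (rename zeta t) = rename (xi \o zeta) t.
Proof. by rewrite rename_subst_Var subst_rename rename_subst_Var. Qed.

Lemma rename_up_shift xi t : rename (up_ren xi) (shift 1 t) = shift 1 (rename xi t).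
Proof. by rewrite /shift !rename_rename. Qed.

Lemma shiftS n t : shift n.+1 t = shift 1 (shift n t).
Proof. by rewrite /shift rename_rename. Qed.

Lemma rename_subst xi s t : rename xi (subst s t) = subst (rename xi \o s) t.
Proof.
elim: t s xi => //= [A IHA B IHB|A IHA M IHM|M IHM N IHN] s xi.
- rewrite IHA IHB; congr Pi; apply: subst_ext; case=> //= n.
  exact: rename_up_shift.
- rewrite IHA IHM; congr Lam; apply: subst_ext; case=> //= n.
  exact: rename_up_shift.
- by rewrite IHM IHN.
Qed.

Lemma subst_up_shift s t : subst (up s) (shift 1 t) = shift 1 (subst s t).
Proof. by rewrite /shift subst_rename rename_subst. Qed.

Lemma subst_subst s r t : subst s (subst r t) = subst (subst s \o r) t.
Proof.
elim: t s r => //= [A IHA B IHB|A IHA M IHM|M IHM N IHN] s r.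
- rewrite IHA IHB; congr Pi; apply: subst_ext; case=> //= n.
  exact: subst_up_shift.
- rewrite IHA IHM; congr Lam; apply: subst_ext; case=> //= n.
  exact: subst_up_shift.
- by rewrite IHM IHN.
Qed.

Lemma inst_shift N t : inst N (shift 1 t) = t.
Proof. by rewrite /inst /shift subst_rename -[RHS]subst_Var; apply: subst_ext. Qed.

(** This is what lets a substitution stay delayed while a product is applied: the argument is merely
    consed onto it. *)
Lemma inst_subst_up N s t : inst N (subst (up s) t) = subst (scons N s) t.
Proof.
rewrite /inst subst_subst; apply: subst_ext; case=> //= n.
exact: inst_shift.
Qed.

Lemma rename_inst xi N t : rename xi (inst N t) = inst (rename xi N) (rename (up_ren xi) t).
Proof. by rewrite /inst rename_subst subst_rename; apply: subst_ext; case. Qed.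

(** It exhibits the body of an abstraction as the contractum of the weakened abstraction applied to
    the new variable. *)
Lemma inst_Var0_up_shift t : inst (Var 0) (rename (up_ren (addn 1)) t) = t.
Proof. by rewrite /inst subst_rename -[RHS]subst_Var; apply: subst_ext; case. Qed.

Lemma subst_apps s M Ns : subst s (apps M Ns) = apps (subst s M) (map (subst s) Ns).
Proof. by elim: Ns M => //= N Ns IH M; rewrite IH. Qed.

(** * Weakening of typing, and typing with delayed substitutions *)

Lemma wf_ctx_typing Sg (G : context C) M A : typing Sg G M A -> wf_ctx Sg G.
Proof. by elim. Qed.

Lemma wf_ctx_cons_inv Sg (G : context C) A :
  wf_ctx Sg (A :: G) -> wf_ctx Sg G /\ typing Sg G A (Sort sType).
Proof. by move=> H; inversion H; subst. Qed.

Lemma conv_rename Sg xi M N : conv Sg M N -> conv Sg (rename xi M) (rename xi N).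
Proof.
move=> H; elim: H xi => /=.
- by move=> A {}M {}N xi; rewrite rename_inst; apply: conv_beta.
- by move=> G {}M {}N s HR xi; rewrite !rename_subst; apply: conv_rule HR.
- by move=> *; apply: conv_refl.
- by move=> *; apply: conv_sym.
- by move=> ? ? ? _ IH1 _ IH2 xi; apply: conv_trans (IH1 xi) (IH2 xi).
- by move=> *; apply: conv_pi.
- by move=> *; apply: conv_lam.
- by move=> *; apply: conv_app.
Qed.

(** The rule for constants uses the declared type unshifted in every context, so renaming can
    preserve typing only if declared types are closed; invariance under substitution expresses this
    without a notion of free index. *)
Definition closed_decls (Sg : signature C) :=
  forall c A, List.In (Decl c A) Sg -> forall s, subst s A = A.

(** Context entries live in the scope of their tails only, so they are compared after being shifted
    into the full contexts. *)
Definition ren_ok (G D : context C) xi := forall n A, onth G n = Some A ->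
  exists2 A', onth D (xi n) = Some A' & shift (xi n).+1 A' = rename xi (shift n.+1 A).

Lemma ren_ok_up G D xi A : ren_ok G D xi -> ren_ok (A :: G) (rename xi A :: D) (up_ren xi).
Proof.
move=> ok [|n] B /=.
  by case=> <-; exists (rename xi A) => //; rewrite rename_up_shift.
case/ok=> A' eA' E; exists A' => //.
by rewrite shiftS E -rename_up_shift -shiftS.
Qed.

(** Well-formedness of the target context is a hypothesis, so induction on typing alone is enough:
    under a binder, the induction hypothesis for the domain supplies the well-formedness of the
    extended context. *)
Lemma typing_rename Sg G D xi M A : closed_decls Sg ->
  typing Sg G M A -> wf_ctx Sg D -> ren_ok G D xi -> typing Sg D (rename xi M) (rename xi A).
Proof.
move=> cl H; elim: H D xi => {G M A} /=.
- by move=> G n A _ eA D xi wfD /(_ _ _ eA) [A' eA' <-]; apply: typing_var.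
- move=> G c A _ cA D xi wfD _; rewrite rename_subst_Var (cl _ _ cA).
  exact: typing_cst.
- by move=> G _ D xi wfD _; apply: typing_type.
- move=> G A B s _ IHA _ IHB D xi wfD ok; apply: typing_pi; first exact: IHA.
  by apply: IHB; [apply: wf_cons => //; apply: IHA|apply: ren_ok_up].
- move=> G A M B _ IHA _ IHB D xi wfD ok; apply: typing_lam; first exact: IHA.
  by apply: IHB; [apply: wf_cons => //; apply: IHA|apply: ren_ok_up].
- move=> G M N A B _ IHM _ IHN D xi wfD ok; rewrite rename_inst.
  by apply: typing_app; [apply: IHM|apply: IHN].
- move=> G M A B _ IHM _ IHB cAB D xi wfD ok.
  by apply: typing_conv (IHM _ _ wfD ok) (IHB _ _ wfD ok) _; apply: conv_rename.
Qed.

Lemma typing_weaken Sg G X M A : closed_decls Sg ->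
  wf_ctx Sg (X :: G) -> typing Sg G M A -> typing Sg (X :: G) (shift 1 M) (shift 1 A).
Proof.
move=> cl wf H; apply: (typing_rename cl H wf) => n B eB.
by exists B; rewrite // -/(shift 1 _) -shiftS.
Qed.

(* Keeping the substitution delayed makes the type of a constant applied to several
   arguments reduce to its expected form by mere computation. *)
Lemma typing_app_subst Sg (G : context C) M N A B s :
  typing Sg G M (subst s (Pi A B)) -> typing Sg G N (subst s A) ->
  typing Sg G (App M N) (subst (scons N s) B).
Proof. by move=> /= HM HN; rewrite -inst_subst_up; apply: typing_app HM HN. Qed.

(** A closed type absorbs any substitution, which provides the starting point for a chain of
    [typing_app_subst]. *)
Lemma typing_cst_subst Sg (G : context C) c A s : closed_decls Sg ->
  wf_ctx Sg G -> List.In (Decl c A) Sg -> typing Sg G (Cst c) (subst s A).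
Proof. by move=> cl wf cA; rewrite (cl _ _ cA); apply: typing_cst. Qed.

End Calculus.

(** * Free variables, typing and substitution in HOL *)


(** The generated principle says nothing about the types nested in the argument list. The calls of
    [clear IH] keep automation from closing a goal with an unguarded recursive call. *)
Lemma hty_nested_ind (P : hty -> Prop) :
  (forall a, P (TVar a)) ->
  (forall p As, (forall A, A \in As -> P A) -> P (TOp p As)) -> forall A, P A.
Proof.
move=> HV HO; fix IH 1; case=> [a|p As]; first exact: HV.
apply: HO; elim: As => [|A As IHAs] B; first by clear IH.
by rewrite inE => /predU1P [->|]; [apply: IH|clear IH; apply: IHAs].
Qed.

Lemma in_ftv_ty_TOp p As a :
  reflect (exists2 A, A \in As & a \in ftv_ty A) (a \in ftv_ty (TOp p As)).
Proof. exact: flatten_mapP. Qed.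

Lemma subst_ty_TVar_notin theta a : a \notin unzip1 theta -> subst_ty theta (TVar a) = TVar a.
Proof. by move=> /= /negbTE ->. Qed.

Lemma subst_ty_id theta A :
  (forall a, a \in ftv_ty A -> a \notin unzip1 theta) -> subst_ty theta A = A.
Proof.
elim/hty_nested_ind: A => [a H|p As IH H].
  by apply: subst_ty_TVar_notin; apply: H; rewrite mem_head.
rewrite /=; congr TOp; rewrite -[RHS]map_id; apply/eq_in_map => A AAs.
by apply: IH => // a aA; apply: H; apply/in_ftv_ty_TOp; exists A.
Qed.

Lemma subst_ty_TVar_in theta a :
  a \in unzip1 theta -> subst_ty theta (TVar a) \in unzip2 theta.
Proof.
by move=> /= aT; rewrite aT; apply: mem_nth; rewrite size_map -(size_map fst) index_mem.
Qed.

(** Lookup finds the first occurrence, hence uniqueness. The lemma turns the arguments of a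
    TypeSubst redex into values of a single function at the abstracted names. *)
Lemma map_subst_ty_TVar theta :
  uniq (unzip1 theta) -> [seq subst_ty theta (TVar a) | a <- unzip1 theta] = unzip2 theta.
Proof.
move=> U; apply: (@eq_from_nth _ tbool) => [|i]; first by rewrite !size_map.
rewrite size_map => Hi; rewrite (nth_map 0) //= mem_nth // index_uniq //.
by apply: set_nth_default; rewrite size_map -(size_map fst).
Qed.

Lemma wf_subst_ty S theta A :
  all (wf_hty S) (unzip2 theta) -> wf_hty S A -> wf_hty S (subst_ty theta A).
Proof.
move=> /allP wfT; elim/hty_nested_ind: A => [a _|p As IH /= /andP [ar /allP wfAs]].
  have [aT|aT] := boolP (a \in unzip1 theta); last by rewrite subst_ty_TVar_notin.
  by apply: wfT; apply: subst_ty_TVar_in.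
rewrite size_map ar /=; apply/allP => _ /mapP [A AAs ->].
by apply: IH => //; apply: wfAs.
Qed.

Lemma in_ftv_subst_ty theta A a : a \in ftv_ty (subst_ty theta A) ->
  exists2 b, b \in ftv_ty A & a \in ftv_ty (subst_ty theta (TVar b)).
Proof.
elim/hty_nested_ind: A => [b H|p As IH]; first by exists b; rewrite ?mem_head.
case/in_ftv_ty_TOp => _ /mapP [A AAs ->] /(IH _ AAs) [b bA aT].
by exists b => //; apply/in_ftv_ty_TOp; exists A.
Qed.

Lemma in_ftv_subst_TVar theta a b : a \in ftv_ty (subst_ty theta (TVar b)) ->
  (a = b /\ b \notin unzip1 theta) \/ a \in flatten (map ftv_ty (unzip2 theta)).
Proof.
have [bT|bT] := boolP (b \in unzip1 theta).
  move=> H; right; apply/flatten_mapP; exists (subst_ty theta (TVar b)) => //.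
  exact: subst_ty_TVar_in.
by rewrite subst_ty_TVar_notin // inE => /eqP ->; left.
Qed.

(** Instances of polymorphic constants are stable under substitution because [ps] covers the type: a
    variable outside [ps] would be touched by [theta] on the left only. *)
Lemma subst_ty_zip theta ps As A :
  size As = size ps -> {subset ftv_ty A <= ps} ->
  subst_ty theta (subst_ty (zip ps As) A) = subst_ty (zip ps (map (subst_ty theta) As)) A.
Proof.
move=> sz; elim/hty_nested_ind: A => [a H|p Bs IH H].
  have aps : a \in ps by apply: H; rewrite mem_head.
  rewrite /= !unzip1_zip ?unzip2_zip ?size_map ?sz // aps.
  by rewrite (nth_map (TVar a)) // sz index_mem.
rewrite /= -!map_comp; congr TOp; apply/eq_in_map => A AAs /=.
by apply: IH => // a aA; apply: H; apply/in_ftv_ty_TOp; exists A.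
Qed.

(** Local closure. [HBound n] is translated to [Var n] whatever the environment, so the translation
    commutes with substitution and weakening only on terms without dangling indices. *)
Fixpoint lc (k : nat) (M : hterm) : bool :=
  match M with
  | HBound n => n < k
  | HLam _ M => lc k.+1 M
  | HApp M N => lc k M && lc k N
  | _ => true
  end.

Lemma onth_lt (T : Type) (s : seq T) n x : onth s n = Some x -> n < size s.
Proof. by move=> H; rewrite -onthTE H. Qed.

Lemma onth_catl (T : Type) (s t : seq T) n x : onth s n = Some x -> onth (s ++ t) n = Some x.
Proof. by move=> H; rewrite onth_cat (onth_lt H). Qed.

(** * Well-typed HOL terms under closing and substitution *)

Section HOL.
Variable S : hsig.
Hypothesis wfS : wf_hsig S.
Implicit Types (D : seq hty) (M N : hterm) (A B : hty).

Lemma htyping_lc D M A : htyping S D M A -> lc (size D) M.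
Proof.
by elim=> {D M A} //= [D n A H|D M N A B _ -> _ -> //]; apply: onth_lt H.
Qed.

Lemma wf_hcst_ty c A : hcst_ty S c = Some A -> wf_hty S A.
Proof. by case: c => [[<-]|[<-]|j H] //; apply: (allP wfS); apply/onthP; exists j. Qed.

Lemma wf_tarrow A B : wf_hty S (tarrow A B) = wf_hty S A && wf_hty S B.
Proof. by rewrite /= andbT. Qed.

Lemma htyping_wf D M A : htyping S D M A -> all (wf_hty S) D -> wf_hty S A.
Proof.
elim=> {D M A} // [D n A H /allP|D A M B wfA _ IH wfD|D M N A B _ IH _ _ wfD
                 |D c A As cA sz wfAs _].
- by apply; apply/onthP; exists n.
- by rewrite wf_tarrow wfA IH //= wfA.
- by move: (IH wfD); rewrite wf_tarrow => /andP [].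
- by apply: wf_subst_ty (wf_hcst_ty cA); rewrite unzip2_zip ?sz.
Qed.

Lemma ftv_tarrow A B : ftv_ty (tarrow A B) = ftv_ty A ++ ftv_ty B.
Proof. by rewrite /= cats0. Qed.

(** Binders, free variables and constants all carry types, so a type cannot contain a variable that
    the term and its bound-variable types lack. Thus the type arguments inserted by the translation
    use declared names only. *)
Lemma htyping_ftv D M A : htyping S D M A ->
  {subset ftv_ty A <= ftv M ++ flatten (map ftv_ty D)}.
Proof.
elim=> {D M A} [D n A H|D x A _|D A M B _ _ IH|D M N A B _ IH _ _|D c A As _ sz _] a.
- by move=> aA; apply/flatten_mapP; exists A => //; apply/onthP; exists n.
- by rewrite mem_cat => ->.
- rewrite ftv_tarrow /= !mem_cat => /orP [->//|/IH]; rewrite /= !mem_cat.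
  by case/or3P => ->; rewrite ?orbT.
- move=> aB; have := IH a; rewrite ftv_tarrow /= !mem_cat aB orbT => /(_ isT).
  by case/orP => ->; rewrite ?orbT.
- case/in_ftv_subst_ty => b; rewrite -mem_undup => bA.
  case/in_ftv_subst_TVar => [[_]|]; first by rewrite unzip1_zip ?sz // bA.
  by rewrite unzip2_zip ?sz //= mem_cat => ->.
Qed.

Lemma ftv_fv M v a : v \in fv M -> a \in ftv_ty v.2 -> a \in ftv M.
Proof.
elim: M => //= [x A|A M IH|M IHM N IHN].
- by rewrite inE => /eqP ->.
- by rewrite mem_cat => vM aA; rewrite IH ?orbT.
- rewrite !mem_cat => /orP [vM|vN] aA; first by rewrite IHM.
  by rewrite IHN ?orbT.
Qed.

Lemma htyping_fv_wf D M A v : htyping S D M A -> v \in fv M -> wf_hty S v.2.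
Proof.
elim=> {D M A} //= [D x A wfA|D M N A B _ IHM _ IHN].
  by rewrite inE => /eqP ->.
by rewrite mem_cat => /orP [/IHM|/IHN].
Qed.

Lemma htyping_weaken D D' M A : htyping S D M A -> htyping S (D ++ D') M A.
Proof.
elim=> {D M A} [D n A H|D x A H|D A M B H _ IH|D M N A B _ IHM _ IHN|D c A As H1 H2 H3].
- by apply: ht_bound; apply: onth_catl.
- exact: ht_free.
- exact: ht_lam.
- exact: ht_app IHM IHN.
- exact: ht_cst.
Qed.

(** The new binder is the outermost one, so its index is the number of bound variables already in
    scope. *)
Lemma htyping_close D x A M B : htyping S D M B ->
  htyping S (rcons D A) (close (size D) (x, A) M) B.
Proof.
elim=> {D M B} /= [D n B H|D y B H|D B M B' H _ IH|D M N B B' _ IHM _ IHN|D c B As H1 H2 H3].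
- by apply: ht_bound; rewrite -cats1; apply: onth_catl.
- case: eqP => [[_ ->]|_]; last exact: ht_free.
  by apply: ht_bound; rewrite -cats1 onth_cat ltnn subnn.
- exact: ht_lam.
- exact: ht_app IHM IHN.
- exact: ht_cst.
Qed.

Lemma htyping_habs x A M B :
  wf_hty S A -> htyping S [::] M B -> htyping S [::] (habs x A M) (tarrow A B).
Proof. by move=> wfA /(htyping_close x A) H; apply: ht_lam. Qed.

Lemma htyping_tsubst theta D M A : all (wf_hty S) (unzip2 theta) ->
  htyping S D M A -> htyping S (map (subst_ty theta) D) (tsubst theta M) (subst_ty theta A).
Proof.
move=> wfT; elim=> {D M A} /= [D n A H|D x A H|D A M B H _ IH|D M N A B _ IHM _ IHN
                              |D c A As H1 H2 H3].
- by apply: ht_bound; rewrite onth_map H.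
- by apply: ht_free; apply: wf_subst_ty.
- by apply: ht_lam => //; apply: wf_subst_ty.
- exact: ht_app IHM IHN.
- rewrite subst_ty_zip // => [|a]; last by rewrite mem_undup.
  apply: ht_cst; rewrite ?size_map //.
  by apply/allP => _ /mapP [B BAs ->]; apply: wf_subst_ty => //; apply: (allP H3).
Qed.

Lemma vsubst_HFree_in sigma v : v \in unzip1 sigma ->
  (v, vsubst sigma (HFree v.1 v.2)) \in sigma.
Proof.
case: v => x A /= vs; rewrite vs.
have Hi : index (x, A) (unzip1 sigma) < size sigma by rewrite -(size_map fst) index_mem.
set i := index _ _ in Hi *.
have -> : nth (HFree x A) (unzip2 sigma) i = (nth ((x, A), HFree x A) sigma i).2.
  by rewrite (nth_map ((x, A), HFree x A)).
have {1}-> : (x, A) = (nth ((x, A), HFree x A) sigma i).1.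
  by rewrite -(nth_map _ (x, A)) // nth_index.
by rewrite -surjective_pairing mem_nth.
Qed.

Lemma vsubst_HFree_notin sigma v : v \notin unzip1 sigma ->
  vsubst sigma (HFree v.1 v.2) = HFree v.1 v.2.
Proof. by case: v => x A /= /negbTE ->. Qed.

Lemma map_vsubst_HFree sigma : uniq (unzip1 sigma) ->
  [seq vsubst sigma (HFree v.1 v.2) | v <- unzip1 sigma] = unzip2 sigma.
Proof.
move=> U; apply: (@eq_from_nth _ (HBound 0)) => [|i]; first by rewrite !size_map.
rewrite size_map => Hi; rewrite (nth_map (0, tbool)) //= -surjective_pairing.
rewrite mem_nth // index_uniq //.
by apply: set_nth_default; rewrite size_map -(size_map fst).
Qed.

Lemma vsubst_id sigma M : (forall v, v \in fv M -> v \notin unzip1 sigma) -> vsubst sigma M = M.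
Proof.
elim: M => //= [x A H|A M IH H|M IHM N IHN H].
- by rewrite (negbTE (H _ (mem_head _ _))).
- by rewrite IH.
- by rewrite IHM ?IHN // => v vM; apply: H; rewrite mem_cat vM ?orbT.
Qed.

Definition typed_subst (sigma : tmsubst) :=
  forall x B M, ((x, B), M) \in sigma -> htyping S [::] M B.

Lemma htyping_vsubst sigma D M A : typed_subst sigma ->
  htyping S D M A -> htyping S D (vsubst sigma M) A.
Proof.
move=> Hs; elim=> {D M A} [D n A H|D x A H|D A M B H _ IH|D M N A B _ IHM _ IHN
                              |D c A As H1 H2 H3].
- exact: ht_bound.
- have [vs|vs] := boolP ((x, A) \in unzip1 sigma).
    by apply: (@htyping_weaken [::] D); apply: Hs (vsubst_HFree_in vs).
  by rewrite (vsubst_HFree_notin vs); apply: ht_free.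
- exact: ht_lam.
- exact: ht_app IHM IHN.
- exact: ht_cst.
Qed.

Lemma in_ftv_tsubst theta M a : a \in ftv (tsubst theta M) ->
  exists2 b, b \in ftv M & a \in ftv_ty (subst_ty theta (TVar b)).
Proof.
elim: M => //= [x A|A M IH|M IHM N IHN|c As].
- exact: in_ftv_subst_ty.
- rewrite mem_cat => /orP [/in_ftv_subst_ty|/IH] [b bA ab]; exists b => //.
    by rewrite mem_cat bA.
  by rewrite mem_cat bA orbT.
- rewrite mem_cat => /orP [/IHM|/IHN] [b bA ab]; exists b => //.
    by rewrite mem_cat bA.
  by rewrite mem_cat bA orbT.
- case/flatten_mapP => _ /mapP [A AAs ->] /in_ftv_subst_ty [b bA ab].
  by exists b => //; apply/flatten_mapP; exists A.
Qed.

Lemma fv_tsubst theta M : fv (tsubst theta M) = [seq (v.1, subst_ty theta v.2) | v <- fv M].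
Proof. by elim: M => //= M -> N ->; rewrite map_cat. Qed.

Lemma tsubst_id theta M : (forall a, a \in ftv M -> a \notin unzip1 theta) -> tsubst theta M = M.
Proof.
elim: M => //= [x A H|A M IH H|M IHM N IHN H|c As H].
- by rewrite subst_ty_id.
- by rewrite subst_ty_id ?IH // => a aA; apply: H; rewrite mem_cat aA ?orbT.
- by rewrite IHM ?IHN // => a aA; apply: H; rewrite mem_cat aA ?orbT.
- congr HCst; rewrite -[RHS]map_id; apply/eq_in_map => A AAs; apply: subst_ty_id => a aA.
  by apply: H; apply/flatten_mapP; exists A.
Qed.

Lemma in_fv_vsubst sigma M v : v \in fv (vsubst sigma M) ->
  (v \in fv M /\ v \notin unzip1 sigma) \/ v \in flatten (map fv (unzip2 sigma)).
Proof.
elim: M => [n|x A|A M IH|M IHM N IHN|c As] //.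
- have [vs|vs] := boolP ((x, A) \in unzip1 sigma).
    move=> H; right; apply/flatten_mapP; exists (vsubst sigma (HFree x A)) => //.
    by apply/mapP; exists ((x, A), vsubst sigma (HFree x A)) => //; apply: (vsubst_HFree_in vs).
  by rewrite (vsubst_HFree_notin vs) inE => /eqP ->; left; rewrite eqxx.
- by rewrite /= !mem_cat => /orP [/IHM|/IHN] [[-> ->]|->]; rewrite ?orbT; auto.
Qed.

Lemma in_ftv_vsubst sigma M a : a \in ftv (vsubst sigma M) ->
  a \in ftv M \/ a \in flatten (map ftv (unzip2 sigma)).
Proof.
elim: M => [n|x A|A M IH|M IHM N IHN|c As] //; last by left.
- have [vs|vs] := boolP ((x, A) \in unzip1 sigma).
    move=> H; right; apply/flatten_mapP; exists (vsubst sigma (HFree x A)) => //.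
    by apply/mapP; exists ((x, A), vsubst sigma (HFree x A)) => //; apply: (vsubst_HFree_in vs).
  by rewrite (vsubst_HFree_notin vs); left.
- by rewrite /= !mem_cat => /orP [->|/IH [->|->]]; rewrite ?orbT; auto.
- by rewrite /= !mem_cat => /orP [/IHM|/IHN] [->|->]; rewrite ?orbT; auto.
Qed.

Lemma ftv_close k v M : {subset ftv (close k v M) <= ftv M}.
Proof.
elim: M k => [n|x A|A M IH|M IHM N IHN|c As] k a //=.
- by case: eqP.
- by rewrite !mem_cat => /orP [->//|/IH ->]; rewrite orbT.
- by rewrite !mem_cat => /orP [/IHM|/IHN] ->; rewrite ?orbT.
Qed.

Lemma fv_close k v M : fv (close k v M) = [seq w <- fv M | w != v].
Proof.
elim: M k => //= [x A|M IHM N IHN] k; first by case: eqP.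
by rewrite IHM IHN filter_cat.
Qed.

Lemma htyping_heq A M N : wf_hty S A ->
  htyping S [::] M A -> htyping S [::] N A -> htyping S [::] (heq A M N) tbool.
Proof.
move=> wfA HM HN; apply: (@ht_app _ _ _ _ A _) => //; apply: (@ht_app _ _ _ _ A _) => //.
pose T := tarrow (TVar 0) (tarrow (TVar 0) tbool).
by apply: (@ht_cst S [::] CstEq T [:: A]) => //=; rewrite wfA.
Qed.

Lemma htyping_heq_inv A M N B : htyping S [::] (heq A M N) B ->
  [/\ wf_hty S A, htyping S [::] M A & htyping S [::] N A].
Proof.
move=> H; inversion H as [| | |? ? ? A1 B1 H1 H2|]; subst => {H}.
inversion H1 as [| | |? ? ? A2 B2 H3 H4|]; subst => {H1}.
inversion H3 as [| | | |? ? T ? cT sz wfA e1 e2 e3]; subst.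
(* Computing the type of equality at [[:: A]] identifies both argument types with [A]. *)
case: cT e3 => <- /= [e1 e2 _]; rewrite -e1 in H4; rewrite -e2 in H2.
by move: wfA; rewrite /= andbT.
Qed.

End HOL.

(** * Environments and translations *)


Definition tm_deps (M : hterm) : seq dkvar := map VTy (ftv M) ++ map VTm (fv M).

(** Dependencies run one way only: term variables on type variables, hypotheses on both. This makes
    declaration in the order types, terms, hypotheses always legitimate. *)
Definition deps (v : dkvar) : seq dkvar :=
  match v with
  | VTy _ => [::]
  | VTm (_, A) => map VTy (ftv_ty A)
  | VHyp phi => tm_deps phi
  end.

Definition lc_var (v : dkvar) : bool := if v is VHyp phi then lc 0 phi else true.

Lemma VTy_inj : injective VTy. Proof. by move=> a b []. Qed.
Lemma VTm_inj : injective VTm. Proof. by move=> a b []. Qed.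
Lemma VHyp_inj : injective VHyp. Proof. by move=> a b []. Qed.

Lemma mem_VTy s v : (v \in map VTy s) = if v is VTy a then a \in s else false.
Proof.
case: v => [a|v|phi]; first by rewrite (mem_map VTy_inj).
  by apply/mapP => -[].
by apply/mapP => -[].
Qed.

Lemma mem_VTm s v : (v \in map VTm s) = if v is VTm w then w \in s else false.
Proof.
case: v => [a|v|phi]; last by apply/mapP => -[].
  by apply/mapP => -[].
by rewrite (mem_map VTm_inj).
Qed.

Lemma mem_VHyp s v : (v \in map VHyp s) = if v is VHyp phi then phi \in s else false.
Proof.
case: v => [a|v|phi]; last by rewrite (mem_map VHyp_inj).
  by apply/mapP => -[].
by apply/mapP => -[].
Qed.

Lemma tr_ty_ext e1 e2 A : {in map VTy (ftv_ty A), e1 =1 e2} -> tr_ty e1 A = tr_ty e2 A.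
Proof.
elim/hty_nested_ind: A => [a|p As IH] H /=; first by apply: H; rewrite mem_head.
congr apps; apply/eq_in_map => A AAs; apply: IH => // v; rewrite mem_VTy.
case: v => // a aA; apply: H; rewrite mem_VTy; apply/in_ftv_ty_TOp; by exists A.
Qed.

Lemma tr_tm_ext e1 e2 M : {in tm_deps M, e1 =1 e2} -> tr_tm e1 M = tr_tm e2 M.
Proof.
elim: M e1 e2 => [n|x A|A M IH|M IHM N IHN|c As] e1 e2 H //=.
- by apply: H; rewrite mem_cat mem_VTm mem_head orbT.
- rewrite (@tr_ty_ext e1 e2) => [|v vA]; last first.
    by apply: H; rewrite mem_cat map_cat mem_cat vA.
  rewrite (IH _ (weaken e2)) // => v vM; rewrite /weaken H //.
  by move: vM; rewrite !(mem_cat, map_cat) => /orP [->|->]; rewrite ?orbT.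
- by rewrite (IHM _ e2) ?(IHN _ e2) // => v vM; apply: H; move: vM;
     rewrite !(mem_cat, map_cat) => /orP [->|->]; rewrite ?orbT.
- congr apps; apply/eq_in_map => A AAs; apply: tr_ty_ext => v; rewrite mem_VTy.
  case: v => // a aA; apply: H; rewrite mem_cat mem_VTy; apply/orP; left.
  by apply/flatten_mapP; exists A.
Qed.

Lemma subst_tr_ty s e A : subst s (tr_ty e A) = tr_ty (subst s \o e) A.
Proof.
elim/hty_nested_ind: A => [a|p As IH] //=.
by rewrite subst_apps -map_comp; congr apps; apply/eq_in_map => A /IH.
Qed.

Lemma tr_ty_weaken e A : tr_ty (weaken e) A = shift 1 (tr_ty e A).
Proof.
rewrite /shift rename_subst_Var subst_tr_ty; apply: tr_ty_ext => v _.
by rewrite /weaken /shift rename_subst_Var.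
Qed.

(** The indices below [k] come from HOL binders and not from [e], so the substitution has to fix
    them; [up] maintains this under an abstraction. *)
Lemma subst_tr_tm k s e M : lc k M -> (forall n, n < k -> s n = Var n) ->
  subst s (tr_tm e M) = tr_tm (subst s \o e) M.
Proof.
elim: M k s e => [n|x A|A M IH|M IHM N IHN|c As] k s e //=.
- by move=> nk; apply.
- move=> lcM Hs; rewrite subst_tr_ty (IH k.+1) //; last first.
    by case=> //= n nk; rewrite Hs.
  congr Lam; apply: tr_tm_ext => v _ /=; exact: subst_up_shift.
- by case/andP => lcM lcN Hs; rewrite (IHM k) ?(IHN k).
- by move=> _ _; rewrite subst_apps -map_comp; congr apps; apply: eq_map => A; apply: subst_tr_ty.
Qed.

Lemma tr_tm_weaken e M : lc 0 M -> tr_tm (weaken e) M = shift 1 (tr_tm e M).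
Proof.
move=> lcM; rewrite /shift rename_subst_Var (subst_tr_tm _ lcM) //.
by apply: tr_tm_ext => v _; rewrite /weaken /shift rename_subst_Var.
Qed.

(** A HOL variable captured by a binder and a name that the environment sends to the index of that
    binder translate alike; weakening moves the index along under further binders. *)
Lemma tr_tm_close e1 e2 k v M : lc k M -> e1 (VTm v) = Var k ->
  (forall w, w <> VTm v -> e1 w = e2 w) -> tr_tm e2 (close k v M) = tr_tm e1 M.
Proof.
elim: M k e1 e2 => [n|x A|A M IH|M IHM N IHN|c As] k e1 e2 //=.
- by move=> _ Hv He; case: eqP => [->//|ne /=]; rewrite He // => -[].
- move=> lcM Hv He; congr Lam.
    by congr dterm; apply: tr_ty_ext => w; rewrite mem_VTy; case: w => // a _; rewrite He.
  by apply: IH => //= [|w ne]; rewrite /weaken ?Hv // He.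
- by case/andP => lcM lcN Hv He; rewrite (IHM _ e1) ?(IHN _ e1).
- move=> _ _ He; congr apps; apply: eq_map => A.
  by apply: tr_ty_ext => w; rewrite mem_VTy; case: w => // a _; rewrite He.
Qed.

Lemma tr_tm_habs e x A M : lc 0 M ->
  tr_tm e (habs x A M) = Lam (dterm (tr_ty e A)) (tr_tm (bind (VTm (x, A)) e) M).
Proof.
move=> lcM; congr Lam; apply: tr_tm_close => //; rewrite /bind ?eqxx //.
by move=> w /eqP /negbTE ->.
Qed.

Lemma inst_bind N v e w : inst N (bind v e w) = if w == v then N else e w.
Proof. by rewrite /bind; case: eqP => // _; apply: inst_shift. Qed.

Lemma var_ty_ext e1 e2 v : {in deps v, e1 =1 e2} -> var_ty e1 v = var_ty e2 v.
Proof.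
case: v => [a|[x A]|phi] //= H; first by rewrite (tr_ty_ext H).
by rewrite /tr_prop (tr_tm_ext H).
Qed.

Lemma subst_var_ty s e v : lc_var v -> subst s (var_ty e v) = var_ty (subst s \o e) v.
Proof.
case: v => [a|[x A]|phi] //= H; first by rewrite subst_tr_ty.
by rewrite (subst_tr_tm _ H).
Qed.

Lemma shift_var_ty e v : lc_var v -> shift 1 (var_ty e v) = var_ty (weaken e) v.
Proof.
case: v => [a|[x A]|phi] //= H; first by rewrite tr_ty_weaken.
by rewrite /tr_prop tr_tm_weaken.
Qed.

(** A body of [pis] is an arbitrary function of the environment. Compatibility with pointwise
    equality and with substitution is what makes [pis] behave like syntax. *)
Definition natural (b : env -> dkterm) :=
  (forall e1 e2, e1 =1 e2 -> b e1 = b e2) /\ (forall s e, subst s (b e) = b (subst s \o e)).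

Lemma natural_tr_ty A : natural (fun e => dterm (tr_ty e A)).
Proof.
split=> [e1 e2 E|s e]; first by rewrite (@tr_ty_ext e1 e2).
by rewrite /= subst_tr_ty.
Qed.

Lemma natural_tr_prop phi : lc 0 phi -> natural (tr_prop^~ phi).
Proof.
move=> lcp; split=> [e1 e2 E|s e]; first by rewrite /tr_prop (@tr_tm_ext e1 e2).
by rewrite /= (subst_tr_tm _ lcp).
Qed.

(** * Telescopes of products, abstractions and arguments *)

Lemma bind_ext e1 e2 v : e1 =1 e2 -> bind v e1 =1 bind v e2.
Proof. by move=> E w; rewrite /bind E. Qed.

Lemma pis_ext vs e1 e2 b : natural b -> e1 =1 e2 -> pis vs e1 b = pis vs e2 b.
Proof.
case=> nb _; elim: vs e1 e2 => [|v vs IH] e1 e2 E /=; first exact: nb.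
by rewrite (@var_ty_ext e1 e2) // (IH _ (bind v e2)) //; apply: bind_ext.
Qed.

Lemma subst_pis s vs e b : natural b -> all lc_var vs ->
  subst s (pis vs e b) = pis vs (subst s \o e) b.
Proof.
move=> nb; elim: vs s e => [|v vs IH] s e /=; first by case: nb.
case/andP => lcv lcvs; rewrite subst_var_ty // IH //; congr Pi.
apply: pis_ext => // w; rewrite /bind /=; case: eqP => // _.
exact: subst_up_shift.
Qed.

Definition upd (e f : env) (vs : seq dkvar) : env := fun w => if w \in vs then f w else e w.

(** The scoping condition of a telescope: no name depends on a later one. *)
Definition ordered (vs : seq dkvar) := pairwise (fun v w => w \notin deps v) vs.

Lemma deps_irrefl v : v \notin deps v.
Proof.
by case: v => [a|[x A]|phi] //=; rewrite ?mem_cat ?mem_VTy ?mem_VTm.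
Qed.

Lemma ordered_ty_tm_hyp s1 s2 s3 : ordered (map VTy s1 ++ map VTm s2 ++ map VHyp s3).
Proof.
rewrite /ordered !pairwise_cat !allrel_catr; apply/and3P; split.
- rewrite !allrel_mapl !allrel_mapr; apply/andP; split;
  by apply/allrelP => a w _ _ /=.
- by rewrite pairwise_map; apply/(pairwiseP 0) => i j *.
rewrite allrel_mapl allrel_mapr; apply/and3P; split.
- by apply/allrelP => -[x A] phi _ _ /=; rewrite mem_VTy.
- rewrite pairwise_map; apply/(pairwiseP (0, tbool)) => i j _ _ _.
  by move: (nth _ s2 i) (nth _ s2 j) => [x A] w; rewrite /= mem_VTy.
- rewrite pairwise_map; apply/(pairwiseP (HBound 0)) => i j *.
  by rewrite /= mem_cat mem_VTy mem_VTm.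
Qed.

(** This stands in for a substitution lemma: instantiating products is absorbed by the environment
    in which the body is evaluated. All argument types are stated in the final environment, which
    the ordering permits. *)
Lemma typing_apps_pis Sg G b (f : env) vs e M : natural b -> all lc_var vs -> ordered vs ->
  typing Sg G M (pis vs e b) ->
  (forall v, v \in vs -> typing Sg G (f v) (var_ty (upd e f vs) v)) ->
  typing Sg G (apps M (map f vs)) (b (upd e f vs)).
Proof.
move=> nb; elim: vs e M => [|v vs IH] e M /=; first by case: nb => nb _ _ _; rewrite (nb _ e).
case/andP => lcv lcvs /andP [/allP vvs ord] HM Hf.
(* Instantiating the outermost product amounts to giving [v] the value [f v]. *)
pose e1 : env := fun w => if w == v then f v else e w.
have E : upd e f (v :: vs) =1 upd e1 f vs.
  by move=> w; rewrite /upd /e1 inE; have [->|] := eqVneq w v; rewrite ?if_same.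
have -> : b (upd e f (v :: vs)) = b (upd e1 f vs) by case: nb => nb _; apply: nb.
apply: IH => // [|w wvs].
  have -> : pis vs e1 b = inst (f v) (pis vs (bind v e) b).
    rewrite [RHS]subst_pis //; apply: pis_ext => // w /=; exact/esym/inst_bind.
  apply: typing_app HM _.
  (* The later updates leave the type of [v] alone, as [v] depends neither on itself nor on a later
     name. *)
  rewrite (@var_ty_ext e (upd e f (v :: vs))); first by apply: Hf; rewrite mem_head.
  move=> w wv; rewrite /upd inE; case: eqP => [wE|_] /=.
    by move: (deps_irrefl v); rewrite -{1}wE wv.
  by case: ifP => // /vvs; rewrite wv.
rewrite -(@var_ty_ext (upd e f (v :: vs))); last by move=> u _; apply: E.
by apply: Hf; rewrite inE wvs orbT.
Qed.

(** The fold of [ctx_of] from an arbitrary start, so that it also describes entering the body of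
    [lams]. *)
Definition declare (Ge : context dkcst * env) (vs : seq dkvar) : context dkcst * env :=
  foldl (fun Ge v => (var_ty Ge.2 v :: Ge.1, bind v Ge.2)) Ge vs.

Lemma env_ofE vs : env_of vs = (declare ([::], env0) vs).2.
Proof. by rewrite /env_of /declare; elim: vs [::] env0 => /=. Qed.

Lemma wf_declare_inv Sg Ge vs : wf_ctx Sg (declare Ge vs).1 -> wf_ctx Sg Ge.1.
Proof. by elim: vs Ge => //= v vs IH Ge /IH /= /wf_ctx_cons_inv []. Qed.

Lemma typing_lams Sg G e vs body b (Ge := declare (G, e) vs) :
  wf_ctx Sg Ge.1 -> typing Sg Ge.1 (body Ge.2) (b Ge.2) ->
  typing Sg G (lams vs e body) (pis vs e b).
Proof.
rewrite {}/Ge; elim: vs G e => //= v vs IH G e wf H; apply: typing_lam; last exact: IH.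
by have /wf_ctx_cons_inv [] := wf_declare_inv wf.
Qed.

(** The substitution moved from the formula into the environment. At an abstracted name its value is
    the argument that the TypeSubst redex supplies. *)
Definition ty_env (theta : tysubst) (e : env) : env := fun w =>
  match w with
  | VTy a => tr_ty e (subst_ty theta (TVar a))
  | VTm v => e (VTm (v.1, subst_ty theta v.2))
  | VHyp psi => e (VHyp (tsubst theta psi))
  end.

Lemma tr_ty_subst e theta A : tr_ty e (subst_ty theta A) = tr_ty (ty_env theta e) A.
Proof.
elim/hty_nested_ind: A => [a|p As IH] //=.
by rewrite -map_comp; congr apps; apply/eq_in_map => A /IH.
Qed.

Lemma tr_tm_tsubst e theta M : tr_tm e (tsubst theta M) = tr_tm (ty_env theta e) M.
Proof.
elim: M e => [n|x A|A M IH|M IHM N IHN|c As] e //=.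
- rewrite tr_ty_subst IH; congr Lam; apply: tr_tm_ext => -[a|v|psi] _ //=.
  exact: tr_ty_weaken.
- by rewrite IHM IHN.
- by rewrite -map_comp; congr apps; apply: eq_map => A /=; apply: tr_ty_subst.
Qed.

Definition tm_env (sigma : tmsubst) (e : env) : env := fun w =>
  match w with
  | VTy a => e (VTy a)
  | VTm v => tr_tm e (vsubst sigma (HFree v.1 v.2))
  | VHyp psi => e (VHyp (vsubst sigma psi))
  end.

(** [vsubst] does not lift under a binder while the environment is weakened there; the two agree
    because the substituted terms are locally closed. *)
Lemma tr_tm_vsubst e sigma M : (forall v, v \in sigma -> lc 0 v.2) ->
  tr_tm e (vsubst sigma M) = tr_tm (tm_env sigma e) M.
Proof.
move=> lcs; elim: M e => [n|x A|A M IH|M IHM N IHN|c As] e //=.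
- congr Lam; first by congr dterm; apply: tr_ty_ext => v; rewrite mem_VTy; case: v.
  rewrite IH; apply: tr_tm_ext => -[a|v|psi] _ //; apply: tr_tm_weaken.
  have [vs|vs] := boolP (v \in unzip1 sigma); first exact: lcs (vsubst_HFree_in vs).
  by rewrite vsubst_HFree_notin.
- by rewrite IHM IHN.
- by congr apps; apply: eq_map => A; apply: tr_ty_ext => v; rewrite mem_VTy; case: v.
Qed.

(** * Typing over the signature of HOL *)


Lemma In_map_iff (T : eqType) (U : Type) (f : T -> U) s y :
  List.In y (map f s) <-> exists2 x, x \in s & f x = y.
Proof.
elim: s => [|x s IH] /=; first by split=> // -[].
split=> [[<-|/IH [z zs <-]]|[z]].
- by exists x; rewrite ?mem_head.
- by exists z; rewrite // inE zs orbT.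
- by rewrite inE => /predU1P [->|zs]; [left|right; apply/IH; exists z].
Qed.

Lemma In_cat_iff (T : Type) (s t : seq T) x :
  List.In x (s ++ t) <-> List.In x s \/ List.In x t.
Proof. exact: List.in_app_iff. Qed.

Lemma closed_Sigma S : closed_decls (Sigma S).
Proof.
have cl_iter n s : subst s (iter n (arr dtype) dtype) = iter n (arr dtype) dtype.
  by elim: n => //= n IH; rewrite subst_up_shift IH.
have cl_cst A s : subst s (cst_ty A) = cst_ty A.
  (* [env0] is constantly [Kind], which every substitution fixes. *)
  rewrite [LHS]subst_pis; first exact/pis_ext/(fun _ => erefl)/natural_tr_ty.
    exact: natural_tr_ty.
  by rewrite all_map; apply/allP.
move=> c A; rewrite /Sigma !In_cat_iff => H s.
case: H => [|[/In_map_iff [i _ [_ <-]] //|[|[/In_map_iff [i _ [_ <-]] //|]]]] /=;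
  by do ![case=> [E|]; first by case: E => // _ <-].
Qed.

Section Typing.
Variable S : hsig.
Implicit Types (G : context dkcst) (e : env).
Local Notation ty := (typing (Sigma S)).
Local Notation wf := (wf_ctx (Sigma S)).
Local Notation closedS := (@closed_Sigma S).

Lemma decl_op p n : hop_arity S p = Some n ->
  List.In (Decl (Cop p) (iter n (arr dtype) dtype)) (Sigma S).
Proof.
case: p => [[<-]|[<-]|[<-]|i] /=; [by right; left|by do 2 right; left|by do 3 right; left|].
move=> H; do 4 right; apply/In_cat_iff; left; apply/In_map_iff.
by exists i; [rewrite mem_iota (onth_lt H)|rewrite (onth_nth 0 _ _ _ H)].
Qed.

Lemma decl_cst c A : hcst_ty S c = Some A -> List.In (Decl (Chol c) (cst_ty A)) (Sigma S).
Proof.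
move=> H; rewrite /Sigma !In_cat_iff; case: c H => [[<-]|[<-]|j H].
- by do 2 right; left; do 2 right; left.
- by do 2 right; left; do 3 right; left.
- do 3 right; left; apply/In_map_iff.
  by exists j; [rewrite mem_iota (onth_lt H)|rewrite (onth_nth tbool _ _ _ H)].
Qed.

Local Ltac decl := rewrite /Sigma !In_cat_iff;
  first [ by right; right; left; simpl; tauto
        | by do 4 right; simpl; tauto
        | by left; simpl; tauto ].

Lemma typing_dtype G : wf G -> ty G dtype (Sort sType).
Proof. by move=> w; apply: typing_cst => //; decl. Qed.

Lemma typing_dterm G a : ty G a dtype -> ty G (dterm a) (Sort sType).
Proof.
move=> Ha; apply: (@typing_app _ _ _ _ _ dtype (Sort sType)) (Ha).
by apply: typing_cst (wf_ctx_typing Ha) _; decl.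
Qed.

Lemma typing_tr_ty G e A : wf G -> wf_hty S A ->
  (forall a, a \in ftv_ty A -> ty G (e (VTy a)) dtype) -> ty G (tr_ty e A) dtype.
Proof.
move=> w; elim/hty_nested_ind: A => [a _|p As IH /= /andP [/eqP ar /allP wfAs]] He.
  by apply: He; rewrite mem_head.
have {ar}: ty G (Cst (Cop p)) (iter (size As) (arr dtype) dtype).
  exact: typing_cst (decl_op ar).
have {IH wfAs He}: forall A, A \in As -> ty G (tr_ty e A) dtype.
  move=> A AAs; apply: IH (wfAs A AAs) _ => // a aA; apply: He.
  by apply/flatten_mapP; exists A.
elim: As (Cst _) => //= A As IH M HAs HM; apply: IH => [B BAs|].
  by apply: HAs; rewrite inE BAs orbT.
by rewrite -(inst_shift (tr_ty e A) (iter _ _ _)); apply: typing_app HM _; apply/HAs/mem_head.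
Qed.

Lemma typing_dbool G : wf G -> ty G dbool dtype.
Proof. by move=> w; apply: (@typing_tr_ty G env0 tbool). Qed.

Lemma typing_darrow G a b : ty G a dtype -> ty G b dtype -> ty G (darrow a b) dtype.
Proof.
move=> Ha Hb.
have H : ty G (Cst (Cop OpArrow)) (subst Var (arr dtype (arr dtype dtype))).
  by apply: typing_cst_subst (@decl_op OpArrow 2 _) => //; [exact: closedS|apply: wf_ctx_typing Ha].
exact: (typing_app_subst (typing_app_subst H Ha) Hb).
Qed.

Lemma typing_arr G A B : ty G A (Sort sType) -> ty G B (Sort sType) ->
  ty G (arr A B) (Sort sType).
Proof.
move=> HA HB; apply: typing_pi => //.
by apply: (typing_weaken closedS _ HB); apply: wf_cons (HA); apply: wf_ctx_typing HA.
Qed.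

Lemma conv_dterm_darrow a b :
  conv (Sigma S) (dterm (darrow a b)) (arr (dterm a) (dterm b)).
Proof.
have H : List.In (Rule [:: dtype; dtype] (dterm (darrow (Var 1) (Var 0)))
                    (arr (dterm (Var 1)) (dterm (Var 0)))) (Sigma S) by decl.
(* In the rule, [alpha] has index 1 and [beta] index 0. *)
exact: (conv_rule (scons b (scons a Var)) H).
Qed.

(** A HOL function type is not literally a product; the use of the rewrite rule is confined to this
    lemma and [typing_happ]. *)
Lemma typing_hlam G a b M : ty G a dtype -> ty G b dtype ->
  ty (dterm a :: G) M (shift 1 (dterm b)) -> ty G (Lam (dterm a) M) (dterm (darrow a b)).
Proof.
move=> Ha Hb HM; apply: typing_conv (conv_sym (conv_dterm_darrow a b)).
  by apply: typing_lam HM; apply: typing_dterm.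
by apply: typing_dterm; apply: typing_darrow.
Qed.

Lemma typing_happ G a b M N : ty G a dtype -> ty G b dtype ->
  ty G M (dterm (darrow a b)) -> ty G N (dterm a) -> ty G (App M N) (dterm b).
Proof.
move=> Ha Hb HM HN; rewrite -(inst_shift N (dterm b)); apply: typing_app HN.
apply: typing_conv HM _ (conv_dterm_darrow a b).
by apply: typing_arr; apply: typing_dterm.
Qed.

Lemma typing_deq G a M N : ty G a dtype -> ty G M (dterm a) -> ty G N (dterm a) ->
  ty G (deq a M N) (dterm dbool).
Proof.
move=> Ha HM HN; have w := wf_ctx_typing Ha; have Hb := typing_dbool w.
apply: (typing_happ Ha Hb _ HN); apply: (typing_happ Ha (typing_darrow Ha Hb) _ HM).
have H : ty G (Cst (Chol CstEq))
  (subst Var (Pi dtype (dterm (darrow (Var 0) (darrow (Var 0) dbool))))).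
  by apply: typing_cst_subst => //; [exact: closedS|decl].
exact: typing_app_subst H Ha.
Qed.

(** * Constants for proofs *)

Lemma typing_dproof G p : ty G p (dterm dbool) -> ty G (dproof p) (Sort sType).
Proof.
move=> Hp; apply: (@typing_app _ _ _ _ _ (dterm dbool) (Sort sType)) (Hp).
by apply: typing_cst (wf_ctx_typing Hp) _; decl.
Qed.

Lemma typing_Refl G a x : ty G a dtype -> ty G x (dterm a) ->
  ty G (apps (Cst CRefl) [:: a; x]) (dproof (deq a x x)).
Proof.
move=> Ha Hx; have w := wf_ctx_typing Ha.
have H : ty G (Cst CRefl)
  (subst Var (Pi dtype (Pi (dterm (Var 0)) (dproof (deq (Var 1) (Var 0) (Var 0)))))).
  by apply: typing_cst_subst => //; [exact: closedS|decl].
exact: (typing_app_subst (typing_app_subst H Ha) Hx).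
Qed.

Local Notation "# n" := (Var n) (at level 9, format "# n").

Lemma typing_FunExt G a b f g h : ty G a dtype -> ty G b dtype ->
  ty G f (dterm (darrow a b)) -> ty G g (dterm (darrow a b)) ->
  ty G h (Pi (dterm a) (dproof (deq (shift 1 b) (App (shift 1 f) #0) (App (shift 1 g) #0)))) ->
  ty G (apps (Cst CFunExt) [:: a; b; f; g; h]) (dproof (deq (darrow a b) f g)).
Proof.
move=> Ha Hb Hf Hg Hh; have w := wf_ctx_typing Ha.
have H : ty G (Cst CFunExt) (subst Var
        (Pi dtype (Pi dtype (Pi (dterm (darrow #1 #0)) (Pi (dterm (darrow #2 #1))
           (arr (Pi (dterm #3) (dproof (deq #3 (App #2 #0) (App #1 #0))))
                (dproof (deq (darrow #3 #2) #1 #0)))))))).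
  by apply: typing_cst_subst => //; [exact: closedS|decl].
exact: (typing_app_subst (typing_app_subst (typing_app_subst (typing_app_subst
         (typing_app_subst H Ha) Hb) Hf) Hg) Hh).
Qed.

Lemma typing_AppThm G a b f g x y p q : ty G a dtype -> ty G b dtype ->
  ty G f (dterm (darrow a b)) -> ty G g (dterm (darrow a b)) ->
  ty G x (dterm a) -> ty G y (dterm a) ->
  ty G p (dproof (deq (darrow a b) f g)) -> ty G q (dproof (deq a x y)) ->
  ty G (apps (Cst CAppThm) [:: a; b; f; g; x; y; p; q]) (dproof (deq b (App f x) (App g y))).
Proof.
move=> Ha Hb Hf Hg Hx Hy Hp Hq; have w := wf_ctx_typing Ha.
have H : ty G (Cst CAppThm) (subst Var
        (Pi dtype (Pi dtype (Pi (dterm (darrow #1 #0)) (Pi (dterm (darrow #2 #1))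
           (Pi (dterm #3) (Pi (dterm #4)
              (arr (dproof (deq (darrow #5 #4) #3 #2))
                 (arr (dproof (deq #5 #1 #0))
                      (dproof (deq #4 (App #3 #1) (App #2 #0)))))))))))).
  by apply: typing_cst_subst => //; [exact: closedS|decl].
exact: (typing_app_subst (typing_app_subst (typing_app_subst (typing_app_subst
         (typing_app_subst (typing_app_subst (typing_app_subst
         (typing_app_subst H Ha) Hb) Hf) Hg) Hx) Hy) Hp) Hq).
Qed.

Lemma typing_PropExt G p q h1 h2 : ty G p (dterm dbool) -> ty G q (dterm dbool) ->
  ty G h1 (arr (dproof q) (dproof p)) -> ty G h2 (arr (dproof p) (dproof q)) ->
  ty G (apps (Cst CPropExt) [:: p; q; h1; h2]) (dproof (deq dbool p q)).
Proof.
move=> Hp Hq H1 H2; have w := wf_ctx_typing Hp.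
have H : ty G (Cst CPropExt) (subst Var
        (Pi (dterm dbool) (Pi (dterm dbool)
           (arr (arr (dproof #0) (dproof #1))
              (arr (arr (dproof #1) (dproof #0))
                   (dproof (deq dbool #1 #0))))))).
  by apply: typing_cst_subst => //; [exact: closedS|decl].
exact: (typing_app_subst (typing_app_subst (typing_app_subst
         (typing_app_subst H Hp) Hq) H1) H2).
Qed.

Lemma typing_EqMp G p q h1 h2 : ty G p (dterm dbool) -> ty G q (dterm dbool) ->
  ty G h1 (dproof (deq dbool p q)) -> ty G h2 (dproof p) ->
  ty G (apps (Cst CEqMp) [:: p; q; h1; h2]) (dproof q).
Proof.
move=> Hp Hq H1 H2; have w := wf_ctx_typing Hp.
have H : ty G (Cst CEqMp) (subst Var
        (Pi (dterm dbool) (Pi (dterm dbool)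
           (arr (dproof (deq dbool #1 #0)) (arr (dproof #1) (dproof #0)))))).
  by apply: typing_cst_subst => //; [exact: closedS|decl].
exact: (typing_app_subst (typing_app_subst (typing_app_subst
         (typing_app_subst H Hp) Hq) H1) H2).
Qed.

(** * Translated HOL terms *)

Hypothesis wfS : wf_hsig S.

(** A constant instance is handled like a TypeSubst redex: its arguments are the values, at the type
    parameters, of the environment of the substitution [zip ps As]. *)
Lemma typing_tr_cst G e c A As : wf G -> hcst_ty S c = Some A -> size As = size (ty_params A) ->
  all (wf_hty S) As ->
  (forall a, a \in ftv (HCst c As) -> ty G (e (VTy a)) dtype) ->
  ty G (tr_tm e (HCst c As)) (dterm (tr_ty e (subst_ty (zip (ty_params A) As) A))).
Proof.
move=> w cA sz /allP wfAs He /=; set ps := ty_params A in sz *; set th := zip ps As.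
have u1 : unzip1 th = ps by rewrite unzip1_zip ?sz.
have u2 : unzip2 th = As by rewrite unzip2_zip ?sz.
have -> : map (tr_ty e) As = map (ty_env th e) (map VTy ps).
  rewrite -{1}u2 -map_subst_ty_TVar u1 ?undup_uniq // -!map_comp.
  by apply: eq_map.
(* Updating the junk environment [env0] suffices, since [ps] lists every type variable of [A]. *)
have -> : dterm (tr_ty e (subst_ty th A)) = dterm (tr_ty (upd env0 (ty_env th e) (map VTy ps)) A).
  rewrite tr_ty_subst; congr dterm; apply: tr_ty_ext => v; rewrite mem_VTy /upd mem_VTy.
  by case: v => // a; rewrite mem_undup => ->.
apply: (typing_apps_pis (natural_tr_ty A)).
- by rewrite all_map; apply/allP.
- by have := ordered_ty_tm_hyp ps [::] [::]; rewrite /= cats0.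
- by apply: typing_cst (decl_cst cA).
move=> v; rewrite mem_VTy; case: v => // a aps /=.
have aAs : subst_ty th (TVar a) \in As by rewrite -u2; apply: subst_ty_TVar_in; rewrite u1.
apply: (typing_tr_ty w (wfAs _ aAs)) => b bA; apply: He.
by apply/flatten_mapP; exists (subst_ty th (TVar a)).
Qed.

(** Bound variables translate to indices independently of [e], so they are constrained through
    [Var n] in [G] and named variables through [e]; going under a binder weakens both. *)
Lemma typing_tr_tm D M A : htyping S D M A -> forall G e, wf G -> all (wf_hty S) D ->
  (forall n B, onth D n = Some B -> ty G (Var n) (dterm (tr_ty e B))) ->
  (forall a, a \in ftv M ++ flatten (map ftv_ty D) -> ty G (e (VTy a)) dtype) ->
  (forall v, v \in fv M -> ty G (e (VTm v)) (dterm (tr_ty e v.2))) ->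
  ty G (tr_tm e M) (dterm (tr_ty e A)).
Proof.
elim=> {D M A} [D n A H|D x A H|D A M B wfA HM IH|D M N A B HM IHM HN IHN|D c A As H1 H2 H3]
  G e w wfD Hb Ht Hv.
- exact: Hb.
- by apply: Hv; rewrite mem_head.
- have HA : ty G (tr_ty e A) dtype.
    by apply: typing_tr_ty => // a aA; apply: Ht; rewrite /= !mem_cat aA.
  have w' : wf (dterm (tr_ty e A) :: G) by apply: wf_cons => //; apply: typing_dterm.
  apply: typing_hlam => //.
    apply: typing_tr_ty => // [|a aB]; first by apply: (htyping_wf wfS HM); rewrite /= wfA.
    apply: Ht; move: (htyping_ftv HM aB); rewrite /= !mem_cat.
    by case/or3P => ->; rewrite ?orbT.
  rewrite /shift /= -/(shift 1 _) -tr_ty_weaken; apply: IH => //=; first by rewrite wfA.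
  + case=> [|n] B' /=.
      case=> <-; rewrite tr_ty_weaken.
      by have := @typing_var _ (Sigma S) _ 0 _ w' erefl.
    by move=> /Hb /(typing_weaken closedS w'); rewrite tr_ty_weaken.
  + move=> a aM; apply: (typing_weaken closedS w' (Ht a _)); move: aM.
    by rewrite /= !mem_cat => /or3P [] ->; rewrite ?orbT.
  + by move=> v vM; rewrite tr_ty_weaken; apply: (typing_weaken closedS w' (Hv v vM)).
- have := htyping_wf wfS HM wfD; rewrite wf_tarrow => /andP [wfA wfB].
  (* The domain [A] is not displayed in the application; its type variables are recovered from [M]
     and [D] by [htyping_ftv]. *)
  have Hab a : a \in ftv_ty A ++ ftv_ty B -> ty G (e (VTy a)) dtype.
    rewrite -ftv_tarrow => /(htyping_ftv HM) aM; apply: Ht; move: aM.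
    by rewrite /= !mem_cat => /orP [] ->; rewrite ?orbT.
  apply: (@typing_happ _ (tr_ty e A)).
  + by apply: typing_tr_ty => // a aA; apply: Hab; rewrite mem_cat aA.
  + by apply: typing_tr_ty => // a aA; apply: Hab; rewrite mem_cat aA orbT.
  + apply: IHM => // [a aM|v vM]; [apply: Ht|apply: Hv; rewrite /= mem_cat vM //].
    by move: aM; rewrite /= !mem_cat => /orP [] ->; rewrite ?orbT.
  + apply: IHN => // [a aM|v vM]; [apply: Ht|apply: Hv; rewrite /= mem_cat vM ?orbT //].
    by move: aM; rewrite /= !mem_cat => /orP [] ->; rewrite ?orbT.
- by apply: typing_tr_cst => // a aAs; apply: Ht; rewrite mem_cat aAs.
Qed.

End Typing.

(** * Translated derivations *)


Section Soundness.
Variable S : hsig.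
Hypothesis wfS : wf_hsig S.
Local Notation ty := (typing (Sigma S)).
Local Notation wf := (wf_ctx (Sigma S)).
Local Notation closedS := (@closed_Sigma S).

Definition scoped (tvs : seq nat) (vs : seq hvar) M A :=
  [/\ htyping S [::] M A, {subset ftv M <= tvs} & {subset fv M <= vs}].

Lemma scoped_mono tvs tvs' vs vs' M A : {subset tvs <= tvs'} -> {subset vs <= vs'} ->
  scoped tvs vs M A -> scoped tvs' vs' M A.
Proof. by move=> H1 H2 [H3 H4 H5]; split=> // x; [move/H4/H1|move/H5/H2]. Qed.

Lemma scoped_ty tvs vs M A : scoped tvs vs M A -> wf_hty S A /\ {subset ftv_ty A <= tvs}.
Proof.
case=> H Ht _; split; first exact: (htyping_wf wfS H).
by move=> a /(htyping_ftv H); rewrite /= cats0 => /Ht.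
Qed.

Lemma ftv_heq A M N : ftv (heq A M N) = (ftv_ty A ++ ftv M) ++ ftv N.
Proof. by rewrite /= cats0. Qed.

Lemma scoped_heq tvs vs M N A :
  scoped tvs vs M A -> scoped tvs vs N A -> scoped tvs vs (heq A M N) tbool.
Proof.
move=> HM [HN tN vN]; have [wfA tA] := scoped_ty HM; case: HM => HM tM vM.
split; first exact: htyping_heq.
  by move=> a; rewrite ftv_heq !mem_cat -orbA => /or3P [/tA|/tM|/tN].
by move=> v; rewrite /= mem_cat => /orP [/vM|/vN].
Qed.

Lemma scoped_heq_inv tvs vs M N A B :
  scoped tvs vs (heq A M N) B -> scoped tvs vs M A /\ scoped tvs vs N A.
Proof.
case=> /htyping_heq_inv [wfA HM HN] Ht Hv; split; split=> //.
- by move=> a aM; apply: Ht; rewrite ftv_heq !mem_cat aM orbT.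
- by move=> v vM; apply: Hv; rewrite /= mem_cat vM.
- by move=> a aM; apply: Ht; rewrite ftv_heq !mem_cat aM orbT.
- by move=> v vM; apply: Hv; rewrite /= mem_cat vM orbT.
Qed.

Lemma scoped_app tvs vs M N A B :
  scoped tvs vs M (tarrow A B) -> scoped tvs vs N A -> scoped tvs vs (HApp M N) B.
Proof.
case=> HM tM vM [HN tN vN]; split; first exact: ht_app HM HN.
  by move=> a; rewrite /= mem_cat => /orP [/tM|/tN].
by move=> a; rewrite /= mem_cat => /orP [/vM|/vN].
Qed.

Lemma scoped_habs tvs vs vs' x A M B : wf_hty S A -> {subset ftv_ty A <= tvs} ->
  (forall v, v \in vs' -> v != (x, A) -> v \in vs) ->
  scoped tvs vs' M B -> scoped tvs vs (habs x A M) (tarrow A B).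
Proof.
move=> wfA tA Hvs [HM tM vM]; split; first exact: htyping_habs.
  by move=> a; rewrite /= mem_cat => /orP [/tA|/ftv_close /tM].
move=> v; rewrite /= fv_close mem_filter => /andP [ne /vM vvs]; exact: Hvs.
Qed.

Definition scoped_vars (tvs : seq nat) (vs : seq hvar) :=
  forall v, v \in vs -> wf_hty S v.2 /\ {subset ftv_ty v.2 <= tvs}.

Lemma scoped_vars_fv tvs M A : htyping S [::] M A -> {subset ftv M <= tvs} ->
  scoped_vars tvs (fv M).
Proof.
move=> HM tM v vM; split; first exact: htyping_fv_wf HM vM.
by move=> a aA; apply/tM/ftv_fv/aA.
Qed.

Lemma scoped_vars_cat tvs tvs' vs vs' : scoped_vars tvs vs -> scoped_vars tvs' vs' ->
  scoped_vars (tvs ++ tvs') (vs ++ vs').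
Proof.
move=> H H' v; rewrite mem_cat => /orP [/H|/H'] [wfv sub]; split=> // a /sub;
by rewrite mem_cat => ->; rewrite ?orbT.
Qed.

Lemma subset_catl (T : eqType) (s t : seq T) : {subset s <= s ++ t}.
Proof. by move=> x xs; rewrite mem_cat xs. Qed.

Lemma subset_catr (T : eqType) (s t : seq T) : {subset t <= s ++ t}.
Proof. by move=> x xs; rewrite mem_cat xs orbT. Qed.

Lemma scoped_tsubst theta tvs vs M A : all (wf_hty S) (unzip2 theta) -> scoped tvs vs M A ->
  scoped ([seq a <- tvs | a \notin unzip1 theta] ++ flatten (map ftv_ty (unzip2 theta)))
         [seq (v.1, subst_ty theta v.2) | v <- vs] (tsubst theta M) (subst_ty theta A).
Proof.
move=> wfT [HM tM vM]; split; first exact: (htyping_tsubst wfT HM).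
  move=> a /in_ftv_tsubst [b /tM bM] /in_ftv_subst_TVar [[-> bT]|aT]; rewrite mem_cat ?aT ?orbT //.
  by rewrite mem_filter bT bM.
by move=> v; rewrite fv_tsubst => /mapP [w /vM wM ->]; apply: map_f.
Qed.

Lemma scoped_vsubst sigma tvs vs M A : typed_subst S sigma -> scoped tvs vs M A ->
  scoped (tvs ++ flatten [seq ftv_ty v.2 | v <- unzip1 sigma] ++ flatten (map ftv (unzip2 sigma)))
         ([seq v <- vs | v \notin unzip1 sigma] ++ flatten (map fv (unzip2 sigma)))
         (vsubst sigma M) A.
Proof.
move=> Hs [HM tM vM]; split; first exact: htyping_vsubst.
  by move=> a /in_ftv_vsubst [/tM|] H; rewrite !mem_cat H ?orbT.
move=> v /in_fv_vsubst [[/vM H1 H2]|H]; rewrite mem_cat ?H ?orbT //.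
by rewrite mem_filter H1 H2.
Qed.

(** A derivation may contain variables that its conclusion has lost, as with EqMp, so scoping refers
    to the variables recorded for the derivation. The third clause ensures that the types of
    recorded term variables can be declared. *)
Lemma deriv_scoped G phi (d : deriv S G phi) :
  [/\ scoped (deriv_ftv d) (deriv_fv d) phi tbool,
      forall psi, psi \in G -> scoped (deriv_ftv d) (deriv_fv d) psi tbool
    & scoped_vars (deriv_ftv d) (deriv_fv d)].
Proof.
elim: d => {G phi} /=
  [M A HM
  |G x A B M N wfA xG d [IH1 IH2 IH3]
  |G D A B F F' M N d1 [IH1 IH2 IH3] d2 [IH1' IH2' IH3']
  |x A M B wfA HM
  |phi Hphi
  |G D phi psi d1 [IH1 IH2 IH3] d2 [IH1' IH2' IH3']
  |G D phi psi d1 [IH1 IH2 IH3] d2 [IH1' IH2' IH3']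
  |G phi theta U wfT d [IH1 IH2 IH3]
  |G phi sigma U Hs d [IH1 IH2 IH3]].
- have sM : scoped (ftv M) (fv M) M A by split.
  split; [exact: scoped_heq|by move=> psi; rewrite in_fset0|exact: scoped_vars_fv HM _].
- have [sM sN] := scoped_heq_inv IH1.
  have tA := @subset_catl _ (ftv_ty A) (deriv_ftv d).
  split.
  + apply: scoped_heq; apply: (scoped_habs wfA tA (vs' := deriv_fv d)).
    * by move=> v H1 H2; rewrite mem_filter H1 H2.
    * by apply: scoped_mono sM => //; apply: subset_catr.
    * by move=> v H1 H2; rewrite mem_filter H1 H2.
    * by apply: scoped_mono sN => //; apply: subset_catr.
  + move=> psi psiG; have [H1 H2 H3] := IH2 _ psiG; split=> // [a /H2|v vpsi].
      exact: subset_catr.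
    (* The side condition keeps [(x, A)], which is no longer recorded, out of the hypotheses. *)
    rewrite mem_filter H3 // andbT; apply: contraNneq (xG _ psiG) => <-; exact: vpsi.
  + move=> v; rewrite mem_filter => /andP [_ /IH3 [wfv sub]]; split=> // a /sub.
    exact: subset_catr.
- have [sF sF'] := scoped_heq_inv IH1; have [sM sN] := scoped_heq_inv IH1'.
  have L := scoped_mono (@subset_catl _ (deriv_ftv d1) (deriv_ftv d2))
                        (@subset_catl _ (deriv_fv d1) (deriv_fv d2)).
  have R := scoped_mono (@subset_catr _ (deriv_ftv d1) (deriv_ftv d2))
                        (@subset_catr _ (deriv_fv d1) (deriv_fv d2)).
  split; last exact: scoped_vars_cat.
    by apply: scoped_heq; apply: scoped_app; [apply: L sF|apply: R sM|apply: L sF'|apply: R sN].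
  by move=> psi; rewrite in_fsetU => /orP [/IH2/L|/IH2'/R].
- have sM : scoped (ftv_ty A ++ ftv M) ((x, A) :: fv M) M B.
    split=> //; first exact: subset_catr.
    by move=> v vM; rewrite inE vM orbT.
  split; [|by move=> psi; rewrite in_fset0|].
    apply: scoped_heq => //; apply: scoped_app.
      by apply: (scoped_habs wfA _ _ sM); [apply: subset_catl|].
    split; [exact: ht_free|exact: subset_catl|].
    by move=> v; rewrite /= !inE => ->.
  move=> v; rewrite inE => /predU1P [->|vM]; first by split=> //; apply: subset_catl.
  by apply: (scoped_vars_fv HM) vM; apply: subset_catr.
- have H : scoped (ftv phi) (fv phi) phi tbool by split.
  split=> // [psi|]; first by rewrite in_fset1 => /eqP ->.
  exact: scoped_vars_fv Hphi _.
- have [_ spsi] := scoped_heq_inv IH1.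
  have L := scoped_mono (@subset_catl _ (deriv_ftv d1) (deriv_ftv d2))
                        (@subset_catl _ (deriv_fv d1) (deriv_fv d2)).
  have R := scoped_mono (@subset_catr _ (deriv_ftv d1) (deriv_ftv d2))
                        (@subset_catr _ (deriv_fv d1) (deriv_fv d2)).
  split; [exact: L spsi| |exact: scoped_vars_cat].
  by move=> chi; rewrite in_fsetU => /orP [/IH2/L|/IH2'/R].
- have L := scoped_mono (@subset_catl _ (deriv_ftv d1) (deriv_ftv d2))
                        (@subset_catl _ (deriv_fv d1) (deriv_fv d2)).
  have R := scoped_mono (@subset_catr _ (deriv_ftv d1) (deriv_ftv d2))
                        (@subset_catr _ (deriv_fv d1) (deriv_fv d2)).
  split; [by apply: scoped_heq; [apply: L IH1|apply: R IH1']| |exact: scoped_vars_cat].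
  by move=> chi; rewrite in_fsetU !in_fsetD1 => /orP [] /andP [_] => [/IH2/L|/IH2'/R].
- split; first exact: (scoped_tsubst wfT IH1).
    by move=> _ /imfsetP [psi /= /IH2 H ->]; apply: (scoped_tsubst wfT H).
  move=> _ /mapP [v /IH3 [wfv sub] ->] /=; split; first exact: wf_subst_ty.
  move=> a /in_ftv_subst_ty [b /sub bv] /in_ftv_subst_TVar [[-> bT]|aT];
    rewrite mem_cat ?aT ?orbT //.
  by rewrite mem_filter bT bv.
- split; first exact: (scoped_vsubst Hs IH1).
    by move=> _ /imfsetP [psi /= /IH2 H ->]; apply: (scoped_vsubst Hs H).
  move=> v; rewrite mem_cat mem_filter => /orP [/andP [_ /IH3 [wfv sub]]|].
    by split=> // a /sub; apply: subset_catl.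
  case/flatten_mapP => _ /mapP [[[x B] M] Ms ->] /= vM.
  apply: (scoped_vars_fv (Hs _ _ _ Ms)) vM => a aM; do 2 apply: subset_catr.
  by apply/flatten_mapP; exists M => //; apply/mapP; exists ((x, B), M).
Qed.

(** * Good names and declared contexts *)

Definition wf_var (v : dkvar) : Prop :=
  match v with
  | VTy _ => True
  | VTm (_, A) => wf_hty S A
  | VHyp phi => htyping S [::] phi tbool
  end.

Definition good G (e : env) v := ty G (e v) (var_ty e v).

Lemma wf_var_lc v : wf_var v -> lc_var v.
Proof. by case: v => [a|[x A]|phi] //= /htyping_lc. Qed.

Lemma typing_scoped_ty G e (tvs : seq nat) A : wf G -> wf_hty S A -> {subset ftv_ty A <= tvs} ->
  (forall a, a \in tvs -> good G e (VTy a)) -> ty G (tr_ty e A) dtype.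
Proof. by move=> w wfA sub H; apply: typing_tr_ty => // a /sub /H. Qed.

Lemma typing_scoped G e tvs vs M A : wf G -> scoped tvs vs M A ->
  (forall a, a \in tvs -> good G e (VTy a)) -> (forall v, v \in vs -> good G e (VTm v)) ->
  ty G (tr_tm e M) (dterm (tr_ty e A)) /\ ty G (tr_ty e A) dtype.
Proof.
move=> w sM Ht Hv; have [wfA tA] := scoped_ty sM; split; last exact: typing_scoped_ty tA Ht.
case: sM => HM tM vM; apply: (typing_tr_tm wfS HM) => // [n B|a|v /vM /Hv].
- by rewrite onth0n.
- by rewrite /= cats0 => /tM /Ht.
- by case: v.
Qed.

Lemma typing_var_ty G e v : wf G -> wf_var v -> (forall u, u \in deps v -> good G e u) ->
  ty G (var_ty e v) (Sort sType).
Proof.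
case: v => [a|[x A]|phi] /= w wfv H; first exact: typing_dtype.
  by apply/typing_dterm/typing_tr_ty => // a aA; apply: (H (VTy a)); rewrite mem_VTy.
apply: typing_dproof.
have sphi : scoped (ftv phi) (fv phi) phi tbool by split.
have [a atv|v vv|] := typing_scoped w sphi (e := e).
- by apply: H; rewrite mem_cat mem_VTy atv.
- by apply: H; rewrite mem_cat mem_VTm vv orbT.
- by [].
Qed.

Lemma var_ty_bind e v w : lc_var w -> v \notin deps w ->
  var_ty (bind v e) w = shift 1 (var_ty e w).
Proof.
move=> lcw vw; rewrite shift_var_ty //; apply: var_ty_ext => u uw.
by rewrite /bind; case: eqP uw => // ->; rewrite (negbTE vw).
Qed.

Lemma good_bind G e v w : lc_var v -> lc_var w -> wf (var_ty e v :: G) ->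
  v \notin deps w -> w = v \/ good G e w -> good (var_ty e v :: G) (bind v e) w.
Proof.
move=> lcv lcw wG vw H; rewrite /good var_ty_bind // {1}/bind.
case: eqP H => [-> _|ne [//|H]]; last exact: (typing_weaken closedS wG H).
exact: (@typing_var _ (Sigma S) _ 0 _ wG erefl).
Qed.

(** Induction from the right follows the order of binding. A name outside [vs] survives when none of
    its dependencies is rebound; asking the same of the outside names mentioned in declared types
    makes those types well formed. *)
Lemma good_declare G e vs (Ge := declare (G, e) vs) : wf G -> ordered vs ->
  (forall v, v \in vs -> wf_var v) ->
  (forall v u, v \in vs -> u \in deps v ->
     u \in vs \/ (lc_var u /\ good G e u /\ forall t, t \in deps u -> t \notin vs)) ->
  wf Ge.1 /\
  forall w, w \in vs \/ (lc_var w /\ good G e w /\ forall t, t \in deps w -> t \notin vs) ->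
    good Ge.1 Ge.2 w.
Proof.
rewrite {}/Ge => wG; elim/last_ind: vs => [|vs v IH].
  by move=> _ _ _; split=> // w [//|[_ []]].
rewrite /ordered -cats1 pairwise_cat allrel1r => /and3P [/allP ov ord _] wfv Hd.
have notin t : t \notin vs ++ [:: v] -> t \notin vs by rewrite mem_cat negb_or => /andP [].
have [u uv|u t uvs tu|w1 H1] := IH ord.
- by apply: wfv; rewrite mem_cat uv.
- have [|tvs|[lct [gt Ht]]] := Hd u t _ tu; first by rewrite mem_cat uvs.
    move: tvs; rewrite mem_cat inE => /orP [|/eqP tE]; first by left.
    (* An earlier name depending on the last one would violate the ordering. *)
    by move: (ov u uvs); rewrite -tE tu.
  by right; split=> //; split=> // r /Ht /notin.
rewrite /declare foldl_cat /= -/(declare _ _); move: w1 H1.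
case: (declare (G, e) vs) => G1 e1 /= w1 H1.
have wv : wf_var v by apply: wfv; rewrite mem_cat mem_head orbT.
have wG1 : wf (var_ty e1 v :: G1).
  apply: wf_cons => //; apply: typing_var_ty => // u uv; apply: H1.
  have [|uvs|[lcu [gu Hu]]] := Hd v u _ uv; first by rewrite mem_cat mem_head orbT.
    move: uvs; rewrite mem_cat inE => /orP [|/eqP uE]; first by left.
    by move: (deps_irrefl v); rewrite -{1}uE uv.
  by right; split=> //; split=> // r /Hu /notin.
split=> // w [|[lcw [gw Hw]]].
  rewrite mem_cat inE => /orP [wvs|/eqP ->].
    apply: good_bind => //; [exact: wf_var_lc| |exact: ov|by right; apply: H1; left].
    by apply/wf_var_lc/wfv; rewrite mem_cat wvs.
  apply: good_bind => //; [exact: wf_var_lc|exact: wf_var_lc|exact: deps_irrefl|by left].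
apply: good_bind => //; first exact: wf_var_lc.
  by apply/negP => /Hw; rewrite mem_cat mem_head orbT.
by right; apply: H1; right; split=> //; split=> // r /Hw /notin.
Qed.

(* [f] gives the argument for each abstracted name; since it agrees with [e] on the
   relevant names outside [vs], updating [e] by [f] on [vs] amounts to [f] itself. *)
Lemma typing_instance G e vs (dv : seq dkvar) (f : env) body phi :
  wf G -> ordered vs -> (forall v, v \in vs -> wf_var v) -> lc 0 phi ->
  (forall v, v \in vs -> {subset deps v <= dv}) -> {subset tm_deps phi <= dv} ->
  (forall w, w \in dv -> lc_var w) ->
  (forall w, w \in dv ->
     w \in vs \/ [/\ good G e w, f w = e w & forall t, t \in deps w -> t \notin vs]) ->
  (forall v, v \in vs -> good G f v) ->
  (forall G' e', wf G' -> (forall w, w \in dv -> good G' e' w) ->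
     ty G' (body e') (tr_prop e' phi)) ->
  ty G (apps (lams vs e body) (map f vs)) (tr_prop f phi).
Proof.
move=> wG ord wfv lcphi vdv phidv lcdv dich Hf Hbody.
have updE : {in dv, upd e f vs =1 f}.
  by move=> w /dich; rewrite /upd; case: ifP => // _ [//|[_ -> _]].
have -> : tr_prop f phi = tr_prop (upd e f vs) phi.
  by rewrite /tr_prop; congr dproof; apply: tr_tm_ext => w /phidv /updE ->.
apply: (typing_apps_pis (natural_tr_prop lcphi)) => //.
- by apply/allP => v /wfv /wf_var_lc.
- have [|wG' Hgood] := @good_declare G e vs wG ord wfv.
    move=> v u vvs uv; have udv := vdv v vvs u uv.
    by have [|[]] := dich u udv; [left|right; split=> //; apply: lcdv].
  apply: typing_lams => //; apply: Hbody => // w wdv; apply: Hgood.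
  by have [|[]] := dich w wdv; [left|right; split=> //; apply: lcdv].
move=> v vvs; rewrite (@var_ty_ext _ f); first exact: Hf.
by move=> u uv; apply: updE; apply: vdv uv.
Qed.

Definition deriv_vars G phi (d : deriv S G phi) : seq dkvar :=
  map VTy (deriv_ftv d) ++ map VTm (deriv_fv d) ++ map VHyp (enum_fset G).

Lemma mem_deriv_vars G phi (d : deriv S G phi) v : (v \in deriv_vars d) =
  match v with
  | VTy a => a \in deriv_ftv d
  | VTm w => w \in deriv_fv d
  | VHyp psi => psi \in G
  end.
Proof. by rewrite !mem_cat mem_VTy mem_VTm mem_VHyp; case: v => *; rewrite /= ?orbF. Qed.

Lemma deps_deriv_vars G phi (d : deriv S G phi) v :
  v \in deriv_vars d -> wf_var v /\ {subset deps v <= deriv_vars d}.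
Proof.
have [_ HG Hv] := deriv_scoped d; rewrite mem_deriv_vars; case: v => [a|[x A] vd|psi psiG] //=.
  have [wfA sub] := Hv _ vd; split=> // -[a|w|chi]; rewrite mem_VTy // mem_deriv_vars.
  exact: sub.
have [Hpsi tpsi vpsi] := HG _ psiG; split=> // w; rewrite mem_deriv_vars mem_cat mem_VTy mem_VTm.
by case: w => [a|w|chi] //=; rewrite ?orbF; [apply: tpsi|apply: vpsi].
Qed.

Lemma deriv_vars_lc G phi (d : deriv S G phi) v : v \in deriv_vars d -> lc_var v.
Proof. by case/deps_deriv_vars => /wf_var_lc. Qed.

Lemma tm_deps_deriv G phi (d : deriv S G phi) : {subset tm_deps phi <= deriv_vars d}.
Proof.
have [[_ tphi vphi] _ _] := deriv_scoped d.
move=> w; rewrite mem_deriv_vars mem_cat mem_VTy mem_VTm.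
by case: w => [a|w|chi] //=; rewrite ?orbF; [apply: tphi|apply: vphi].
Qed.

Lemma typing_deriv_scoped G phi (d : deriv S G phi) Ga e M A : wf Ga ->
  (forall w, w \in deriv_vars d -> good Ga e w) -> scoped (deriv_ftv d) (deriv_fv d) M A ->
  ty Ga (tr_tm e M) (dterm (tr_ty e A)) /\ ty Ga (tr_ty e A) dtype.
Proof.
move=> w H sM; apply: (typing_scoped w sM) => [a aT|v vv]; apply: H;
by rewrite mem_deriv_vars.
Qed.

Lemma VHyp_notin_deps phi v : VHyp phi \notin deps v.
Proof. by case: v => [a|[x A]|psi] //=; rewrite ?mem_cat !mem_VTy ?mem_VTm. Qed.

(** * Binders and the individual inference rules *)

Lemma good_binder Ga e v : wf Ga -> wf_var v -> (forall u, u \in deps v -> good Ga e u) ->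
  wf (var_ty e v :: Ga) /\
  forall w, lc_var w -> v \notin deps w -> w = v \/ good Ga e w ->
    good (var_ty e v :: Ga) (bind v e) w.
Proof.
move=> wG wv Hv; have w' : wf (var_ty e v :: Ga) by apply: wf_cons => //; apply: typing_var_ty.
by split=> // w *; apply: good_bind => //; apply: wf_var_lc.
Qed.

Lemma conv_habs_app e x A M : lc 0 M ->
  conv (Sigma S) (tr_tm (bind (VTm (x, A)) e) M) (App (shift 1 (tr_tm e (habs x A M))) (Var 0)).
Proof.
move=> lcM; rewrite tr_tm_habs // -{1}(inst_Var0_up_shift (tr_tm _ M)).
exact/conv_sym/conv_beta.
Qed.

Lemma typing_tr_AbsThm Ga e x A B M N h : wf Ga ->
  ty Ga (tr_ty e A) dtype -> ty Ga (tr_ty e B) dtype ->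
  ty Ga (tr_tm e (habs x A M)) (dterm (darrow (tr_ty e A) (tr_ty e B))) ->
  ty Ga (tr_tm e (habs x A N)) (dterm (darrow (tr_ty e A) (tr_ty e B))) ->
  lc 0 M -> lc 0 N ->
  ty (dterm (tr_ty e A) :: Ga) h (tr_prop (bind (VTm (x, A)) e) (heq B M N)) ->
  ty Ga (apps (Cst CFunExt) [:: tr_ty e A; tr_ty e B; tr_tm e (habs x A M);
                               tr_tm e (habs x A N); Lam (dterm (tr_ty e A)) h])
     (tr_prop e (heq (tarrow A B) (habs x A M) (habs x A N))).
Proof.
move=> w HA HB HM HN lcM lcN Hh; apply: typing_FunExt => //.
have HtA := typing_dterm HA; have w' := wf_cons w HtA.
have HA' := typing_weaken closedS w' HA; have HB' := typing_weaken closedS w' HB.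
have Happ P : ty Ga P (dterm (darrow (tr_ty e A) (tr_ty e B))) ->
    ty (dterm (tr_ty e A) :: Ga) (App (shift 1 P) (Var 0)) (dterm (shift 1 (tr_ty e B))).
  move=> /(typing_weaken closedS w') HP; apply: (typing_happ HA' HB' HP).
  exact: (@typing_var _ (Sigma S) _ 0 _ w' erefl).
(* The abstraction proves equality of the bodies, whereas [FunExt] asks for equality of the
   functions applied to the variable; beta joins the two types. *)
apply: typing_conv (typing_lam HtA Hh) _ _.
  by apply: typing_pi => //; apply: typing_dproof; apply: typing_deq => //; apply: Happ.
have EB : tr_ty (bind (VTm (x, A)) e) B = shift 1 (tr_ty e B).
  by rewrite -tr_ty_weaken; apply: tr_ty_ext => u; rewrite mem_VTy; case: u.
apply: conv_pi; first exact: conv_refl.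
apply: conv_app; first exact: conv_refl.
apply: conv_app; last exact: conv_habs_app.
apply: conv_app; last exact: conv_habs_app.
by rewrite /= EB; apply: conv_refl.
Qed.

Lemma typing_tr_TypeSubst G phi (d : deriv S G phi) theta Ga e
    (U : uniq (unzip1 theta)) (wfT : all (wf_hty S) (unzip2 theta)) :
  (forall Ga e, wf Ga -> (forall w, w \in deriv_vars d -> good Ga e w) ->
     ty Ga (tr_deriv d e) (tr_prop e phi)) ->
  wf Ga -> (forall w, w \in deriv_vars (DTypeSubst U wfT d) -> good Ga e w) ->
  ty Ga (tr_deriv (DTypeSubst U wfT d) e) (tr_prop e (tsubst theta phi)).
Proof.
move=> IH w Hgood; rewrite /tr_prop tr_tm_tsubst -/(tr_prop _ _) /=.
set xs := ty_dep_vars _ _; set hs := ty_dep_hyps _ _.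
pose vs := map VTy (unzip1 theta) ++ map VTm xs ++ map VHyp hs.
(* Each argument is the value of [ty_env] at the abstracted name in the same position. *)
have -> : map (tr_ty e) (unzip2 theta)
         ++ [seq e (VTm (v.1, subst_ty theta v.2)) | v <- xs]
         ++ [seq e (VHyp (tsubst theta psi)) | psi <- hs] = map (ty_env theta e) vs.
  by rewrite -{1}(map_subst_ty_TVar U) !map_cat -!map_comp.
have memvs v : (v \in vs) = match v with
    | VTy a => a \in unzip1 theta
    | VTm v => (v \in deriv_fv d) && has (mem (unzip1 theta)) (ftv_ty v.2)
    | VHyp psi => (psi \in G) && has (mem (unzip1 theta)) (ftv psi)
    end.
  rewrite !mem_cat mem_VTy mem_VTm mem_VHyp; case: v => *; rewrite /= ?orbF //.
    by rewrite mem_filter mem_undup andbC.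
  by rewrite mem_filter andbC.
have sub_dv v : v \in vs -> wf_var v /\ {subset deps v <= deriv_vars d}.
  rewrite memvs; case: v => [a|v|psi] //.
    by case/andP => vd _; apply: deps_deriv_vars; rewrite mem_deriv_vars.
  by case/andP => vd _; apply: deps_deriv_vars; rewrite mem_deriv_vars.
have [[Hphi _ _] _ Hvars] := deriv_scoped d.
have nohas s : ~~ has (mem (unzip1 theta)) s -> forall a, a \in s -> a \notin unzip1 theta.
  by move=> /hasPn H a /H.
apply: (typing_instance (dv := deriv_vars d)) => //.
- exact: ordered_ty_tm_hyp.
- by move=> v /sub_dv [].
- exact: htyping_lc Hphi.
- by move=> v /sub_dv [].
- exact: tm_deps_deriv.
- exact: deriv_vars_lc.
- move=> v; rewrite memvs mem_deriv_vars; case: v => [a|v|psi] vd.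
  + have [aT|aT] := boolP (a \in unzip1 theta); [by left|right; split=> //].
      by apply: Hgood; rewrite mem_deriv_vars /= mem_cat mem_filter aT vd.
    by rewrite /ty_env subst_ty_TVar_notin.
  (* A term variable left unabstracted has a type fixed by [theta], so it is the same name before
     and after the rule. *)
  + rewrite vd /=; have [vT|/nohas vT] := boolP (has _ _); [by left|right].
    have E : subst_ty theta v.2 = v.2 by apply: subst_ty_id.
    split; last 1 first.
    * by case: v vT {vd E} => y B /= vT t; rewrite mem_VTy memvs; case: t.
    * apply: Hgood; rewrite mem_deriv_vars; apply/mapP; exists v => //.
      by rewrite E -surjective_pairing.
    * by rewrite /ty_env E -surjective_pairing.
  + rewrite vd /=; have [vT|/nohas vT] := boolP (has _ _); [by left|right].
    have E : tsubst theta psi = psi by apply: tsubst_id.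
    split; last 1 first.
    * move=> t; rewrite /= mem_cat mem_VTy mem_VTm memvs; case: t => [a|v|chi] //=.
        by rewrite orbF; apply: vT.
      (* A variable of an unabstracted hypothesis is itself unabstracted, since the type variables
         of its type occur in the hypothesis. *)
      move=> vpsi; rewrite negb_and; apply/orP; right; apply/hasPn => a av.
      by apply: vT; apply: ftv_fv av.
    * by apply: Hgood; rewrite mem_deriv_vars -{1}E; apply: in_imfset.
    * by rewrite /ty_env E.
- move=> v; rewrite memvs /good; case: v => [a aT|[y B] /andP [vd _]|psi /andP [psiG _]] /=.
  + have HT := subst_ty_TVar_in aT.
    apply: (typing_tr_ty w (allP wfT _ HT)) => b bT.
    apply: (Hgood (VTy b)); rewrite mem_deriv_vars /= mem_cat; apply/orP; right.
    by apply/flatten_mapP; exists (subst_ty theta (TVar a)).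
  + rewrite -tr_ty_subst; apply: (Hgood (VTm (y, subst_ty theta B))).
    by rewrite mem_deriv_vars; apply/mapP; exists (y, B).
  + rewrite /tr_prop -tr_tm_tsubst; apply: (Hgood (VHyp (tsubst theta psi))).
    by rewrite mem_deriv_vars; apply: in_imfset.
Qed.

(** Substituting terms changes no type of a term variable, so hypotheses are the only dependent
    names to abstract. *)
Lemma typing_tr_TermSubst G phi (d : deriv S G phi) sigma Ga e
    (U : uniq (unzip1 sigma)) (Hs : typed_subst S sigma) :
  (forall Ga e, wf Ga -> (forall w, w \in deriv_vars d -> good Ga e w) ->
     ty Ga (tr_deriv d e) (tr_prop e phi)) ->
  wf Ga -> (forall w, w \in deriv_vars (DTermSubst U Hs d) -> good Ga e w) ->
  ty Ga (tr_deriv (DTermSubst U Hs d) e) (tr_prop e (vsubst sigma phi)).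
Proof.
move=> IH w Hgood.
have lcs v : v \in sigma -> lc 0 v.2 by case: v => -[x B] M /Hs /htyping_lc.
rewrite /tr_prop tr_tm_vsubst // -/(tr_prop _ _) /=.
set hs := tm_dep_hyps _ _; pose vs := map VTm (unzip1 sigma) ++ map VHyp hs.
have -> : map (tr_tm e) (unzip2 sigma) ++ [seq e (VHyp (vsubst sigma psi)) | psi <- hs]
          = map (tm_env sigma e) vs.
  by rewrite -{1}(map_vsubst_HFree U) !map_cat -!map_comp.
have memvs v : (v \in vs) = match v with
    | VTy a => false
    | VTm v => v \in unzip1 sigma
    | VHyp psi => (psi \in G) && has (mem (unzip1 sigma)) (fv psi)
    end.
  rewrite !mem_cat mem_VTm mem_VHyp; case: v => *; rewrite /= ?orbF //.
  by rewrite mem_filter andbC.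
(* [sigma] may bind variables foreign to [d], whose types are nevertheless written in the
   abstractions; their type variables must be tracked too. *)
pose stvs := flatten [seq ftv_ty v.2 | v <- unzip1 sigma].
pose dv := deriv_vars d ++ map VTy stvs.
have sigmaP v : v \in unzip1 sigma -> htyping S [::] (vsubst sigma (HFree v.1 v.2)) v.2.
  by case: v => x B /vsubst_HFree_in /Hs.
have sub_dv v : v \in vs -> wf_var v /\ {subset deps v <= dv}.
  rewrite memvs; case: v => [a|[x B] vs1|psi /andP [psiG _]] //.
    split; first exact: (htyping_wf wfS (sigmaP _ vs1)).
    move=> t /=; rewrite mem_cat !mem_VTy; case: t => // a aB; apply/orP; right.
    by apply/flatten_mapP; exists (x, B).
  have [|wpsi sub] := @deps_deriv_vars _ _ d (VHyp psi); first by rewrite mem_deriv_vars.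
  by split=> // t /sub; apply: subset_catl.
have [[Hphi _ _] _ Hvars] := deriv_scoped d.
apply: (typing_instance (dv := dv)) => //.
- exact: (ordered_ty_tm_hyp [::]).
- by move=> v /sub_dv [].
- exact: htyping_lc Hphi.
- by move=> v /sub_dv [].
- by move=> v /tm_deps_deriv vd; apply: subset_catl.
- move=> v; rewrite mem_cat => /orP [/deriv_vars_lc //|]; rewrite mem_VTy; by case: v.
- move=> v; rewrite memvs mem_cat mem_deriv_vars mem_VTy.
  case: v => [a|v|psi] vd; rewrite ?orbF in vd.
  + right; split=> //; apply: Hgood; rewrite mem_deriv_vars /= !mem_cat.
    by case/orP: vd => ->; rewrite ?orbT.
  + have [vT|vT] := boolP (v \in unzip1 sigma); [by left|right].
    split.
    * by apply: Hgood; rewrite mem_deriv_vars /= mem_cat mem_filter vT vd.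
    * by rewrite /tm_env vsubst_HFree_notin //= -surjective_pairing.
    * by case: v {vd vT} => y B /= t; rewrite mem_VTy memvs; case: t.
  + rewrite vd /=; have [vT|/hasPn vT] := boolP (has _ _); [by left|right].
    have E : vsubst sigma psi = psi by apply: vsubst_id.
    split.
    * by apply: Hgood; rewrite mem_deriv_vars -{1}E; apply: in_imfset.
    * by rewrite /tm_env E.
    * move=> t; rewrite /= mem_cat mem_VTy mem_VTm memvs; case: t => [a|v|chi] //=.
      exact: vT.
- move=> v; rewrite memvs /good; case: v => [//|[y B] vT|psi /andP [psiG _]].
  + have -> : var_ty (tm_env sigma e) (VTm (y, B)) = dterm (tr_ty e B).
      by congr dterm; apply: tr_ty_ext => t; rewrite mem_VTy; case: t.
    have H2 : vsubst sigma (HFree y B) \in unzip2 sigma.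
      by apply/mapP; exists ((y, B), vsubst sigma (HFree y B)) => //; apply: (vsubst_HFree_in vT).
    have sc : scoped (deriv_ftv (DTermSubst U Hs d)) (deriv_fv (DTermSubst U Hs d))
                (vsubst sigma (HFree y B)) B.
      split; first exact: (sigmaP _ vT).
        move=> a aM /=; rewrite !mem_cat; apply/orP; right; apply/orP; right.
        by apply/flatten_mapP; exists (vsubst sigma (HFree y B)).
      move=> v vM /=; rewrite mem_cat; apply/orP; right.
      by apply/flatten_mapP; exists (vsubst sigma (HFree y B)).
    by have [] := typing_deriv_scoped w Hgood sc.
  + rewrite /= /tr_prop -tr_tm_vsubst //; apply: (Hgood (VHyp (vsubst sigma psi))).
    by rewrite mem_deriv_vars; apply: in_imfset.
- move=> G' e' w' Hg; apply: IH => // v vd; apply: Hg; exact: subset_catl.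
Qed.

(** Binding [x] and instantiating it with its own value in [e] gives back [e], so the contractum is
    the translation of [M] in [e]. *)
Lemma conv_habs_beta e x A M : lc 0 M ->
  conv (Sigma S) (tr_tm e M) (App (tr_tm e (habs x A M)) (e (VTm (x, A)))).
Proof.
move=> lcM; rewrite tr_tm_habs //; apply: conv_sym.
have <- : inst (e (VTm (x, A))) (tr_tm (bind (VTm (x, A)) e) M) = tr_tm e M.
  rewrite [LHS](subst_tr_tm _ lcM) //; apply: tr_tm_ext => v _ /=.
  by rewrite -/(inst _ _) inst_bind; case: eqP => // ->.
exact: conv_beta.
Qed.

(** The binder may shadow an earlier meaning of the hypothesis name. No type mentions a hypothesis,
    so no other name is spoiled and the product is an arrow. *)
Lemma typing_tr_discharge G phi (d : deriv S G phi) psi Ga e :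
  (forall Ga e, wf Ga -> (forall w, w \in deriv_vars d -> good Ga e w) ->
     ty Ga (tr_deriv d e) (tr_prop e phi)) ->
  wf Ga -> htyping S [::] psi tbool -> (forall u, u \in tm_deps psi -> good Ga e u) ->
  (forall v, v \in deriv_vars d -> v = VHyp psi \/ good Ga e v) ->
  ty Ga (Lam (tr_prop e psi) (tr_deriv d (bind (VHyp psi) e)))
     (arr (tr_prop e psi) (tr_prop e phi)).
Proof.
move=> IH w Hpsi Hdeps Hgood; have [[/htyping_lc lcphi _ _] _ _] := deriv_scoped d.
have [w' Hbind] := @good_binder Ga e (VHyp psi) w Hpsi Hdeps.
have [_ Hty] := wf_ctx_cons_inv w'; apply: typing_lam => //.
rewrite -(@var_ty_bind e (VHyp psi) (VHyp phi)) ?VHyp_notin_deps //.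
apply: IH => // v vd; apply: Hbind; [exact: deriv_vars_lc vd|exact: VHyp_notin_deps|].
exact: Hgood.
Qed.

Lemma typing_tr_deriv G phi (d : deriv S G phi) Ga e : wf Ga ->
  (forall w, w \in deriv_vars d -> good Ga e w) -> ty Ga (tr_deriv d e) (tr_prop e phi).
Proof.
elim: d Ga e => {G phi}
  [M A HM
  |G x A B M N wfA xG d IH
  |G D A B F F' M N d1 IH1 d2 IH2
  |x A M B wfA HM
  |phi Hphi
  |G D phi psi d1 IH1 d2 IH2
  |G D phi psi d1 IH1 d2 IH2
  |G phi theta U wfT d IH
  |G phi sigma U Hs d IH] Ga e w Hgood.
- have [|H1 H2] := typing_deriv_scoped (M := M) (A := A) w Hgood; first by split.
  exact: typing_Refl.
- set d0 := DAbsThm _ _ _ in Hgood *.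
  have [/scoped_heq_inv [sM sN] _ _] := deriv_scoped d0.
  have [HM HAB] := typing_deriv_scoped w Hgood sM.
  have [HN _] := typing_deriv_scoped w Hgood sN.
  have [/scoped_heq_inv [sM' sN'] HG _] := deriv_scoped d.
  have HtA a : a \in ftv_ty A -> good Ga e (VTy a).
    by move=> aA; apply: Hgood; rewrite mem_deriv_vars /= mem_cat aA.
  have [|w' Hbind] := @good_binder Ga e (VTm (x, A)) w wfA.
    by move=> u; rewrite mem_VTy; case: u => // a; apply: HtA.
  have Hgood' v : v \in deriv_vars d -> good (dterm (tr_ty e A) :: Ga) (bind (VTm (x, A)) e) v.
    move=> vd; apply: Hbind; first exact: deriv_vars_lc vd.
      move: vd; rewrite mem_deriv_vars; case: v => [a|[y C]|psi] //=; first by rewrite mem_VTy.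
      (* Here the side condition is used: the types of the hypotheses do not mention the bound
         [x]. *)
      by move=> /xG nx; rewrite mem_cat mem_VTy mem_VTm.
    (* [(x, A)] is not recorded for the conclusion, so nothing is known of its value in [e]; in the
       premise it is the bound variable. *)
    have [->|/eqP ne] := @eqP _ v (VTm (x, A)); [by left|right].
    apply: Hgood; move: vd; rewrite !mem_deriv_vars /=; case: v ne => [a|y|psi] //= ne.
      by rewrite mem_cat => ->; rewrite orbT.
    by rewrite mem_filter => ->; rewrite andbT; apply: contraNneq ne => ->.
  have lcM : lc 0 M by case: sM' => /htyping_lc.
  have lcN : lc 0 N by case: sN' => /htyping_lc.
  apply: typing_tr_AbsThm => //; [exact: typing_tr_ty| |exact: IH].
  apply: typing_tr_ty => // [|a aB].
    by have [+ _] := scoped_ty sM; rewrite wf_tarrow => /andP [].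
  apply: (Hgood (VTy a)); rewrite mem_deriv_vars.
  by have [_] := scoped_ty sM; apply; rewrite ftv_tarrow mem_cat aB orbT.
- have good1 v : v \in deriv_vars d1 -> good Ga e v.
    rewrite mem_deriv_vars => vd; apply: Hgood; move: vd; rewrite mem_deriv_vars.
    by case: v => [a|v|psi] /=; rewrite ?in_fsetU ?mem_cat => ->.
  have good2 v : v \in deriv_vars d2 -> good Ga e v.
    rewrite mem_deriv_vars => vd; apply: Hgood; move: vd; rewrite mem_deriv_vars.
    by case: v => [a|v|psi] /=; rewrite ?in_fsetU ?mem_cat => ->; rewrite orbT.
  have [/scoped_heq_inv [sF sF'] _ _] := deriv_scoped d1.
  have [/scoped_heq_inv [sM sN] _ _] := deriv_scoped d2.
  have [HF _] := typing_deriv_scoped w good1 sF.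
  have [HF' _] := typing_deriv_scoped w good1 sF'.
  have [HM HA] := typing_deriv_scoped w good2 sM.
  have [HN _] := typing_deriv_scoped w good2 sN.
  apply: typing_AppThm => //; [|exact: IH1|exact: IH2].
  have [wfAB tAB] := scoped_ty sF; apply: typing_tr_ty => // [|a aB].
    by move: wfAB; rewrite wf_tarrow => /andP [].
  apply: (good1 (VTy a)); rewrite mem_deriv_vars; apply: tAB.
  by rewrite ftv_tarrow mem_cat aB orbT.
- set d0 := DBeta _ _ _ in Hgood *.
  have [/scoped_heq_inv [sL sM] _ _] := deriv_scoped d0.
  have [HtM HB] := typing_deriv_scoped w Hgood sM.
  have [HL _] := typing_deriv_scoped w Hgood sL.
  (* [Refl] proves [M = M]; its left side is then beta-expanded. *)
  apply: typing_conv (typing_Refl HB HtM) _ _.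
    by apply: typing_dproof; apply: typing_deq.
  apply: conv_app; first exact: conv_refl.
  apply: conv_app; last exact: conv_refl.
  apply: conv_app; first exact: conv_refl.
  exact: conv_habs_beta (htyping_lc HM).
- by apply: (Hgood (VHyp phi)); rewrite mem_deriv_vars in_fset1.
- have good1 v : v \in deriv_vars d1 -> good Ga e v.
    rewrite mem_deriv_vars => vd; apply: Hgood; move: vd; rewrite mem_deriv_vars.
    by case: v => [a|v|chi] /=; rewrite ?in_fsetU ?mem_cat => ->.
  have good2 v : v \in deriv_vars d2 -> good Ga e v.
    rewrite mem_deriv_vars => vd; apply: Hgood; move: vd; rewrite mem_deriv_vars.
    by case: v => [a|v|chi] /=; rewrite ?in_fsetU ?mem_cat => ->; rewrite orbT.
  have [/scoped_heq_inv [sp sq] _ _] := deriv_scoped d1.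
  have [Hp _] := typing_deriv_scoped w good1 sp.
  have [Hq _] := typing_deriv_scoped w good1 sq.
  by apply: typing_EqMp => //; [exact: IH1|exact: IH2].
- set d0 := DDeductAntiSym _ _ in Hgood *.
  have [/scoped_heq_inv [sp sq] _ _] := deriv_scoped d0.
  have [Hp _] := typing_deriv_scoped w Hgood sp.
  have [Hq _] := typing_deriv_scoped w Hgood sq.
  have Hdeps chi : scoped (deriv_ftv d0) (deriv_fv d0) chi tbool ->
      forall u, u \in tm_deps chi -> good Ga e u.
    case=> _ tchi vchi u; rewrite mem_cat mem_VTy mem_VTm => uchi.
    apply: Hgood; rewrite mem_deriv_vars; case: u uchi => [a|v|xi] //=; rewrite ?orbF.
      exact: tchi.
    exact: vchi.
  apply: typing_PropExt => //.
    apply: typing_tr_discharge => //; [by case: sq|exact: Hdeps|].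
    move=> v; rewrite mem_deriv_vars => vd.
    (* Every hypothesis of the first premise other than [psi] remains in the conclusion. *)
    have [->|/eqP ne] := @eqP _ v (VHyp psi); [by left|right].
    apply: Hgood; rewrite mem_deriv_vars; case: v vd ne => [a|v|chi] vd ne /=.
    + by rewrite mem_cat vd.
    + by rewrite mem_cat vd.
    + have cne : chi != psi by apply: contraNneq ne => ->.
      by rewrite in_fsetU !in_fsetD1 vd cne.
  apply: typing_tr_discharge => //; [by case: sp|exact: Hdeps|].
  move=> v; rewrite mem_deriv_vars => vd.
  have [->|/eqP ne] := @eqP _ v (VHyp phi); [by left|right].
  apply: Hgood; rewrite mem_deriv_vars; case: v vd ne => [a|v|chi] vd ne /=.
  + by rewrite mem_cat vd orbT.
  + by rewrite mem_cat vd orbT.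
  + have cne : chi != phi by apply: contraNneq ne => ->.
    by rewrite in_fsetU !in_fsetD1 vd cne orbT.
- exact: typing_tr_TypeSubst.
- exact: typing_tr_TermSubst.
Qed.

End Soundness.

Theorem theorem15 (S : hsig) (hS : wf_hsig S)
    (G : {fset hterm}) (phi : hterm) (d : deriv S G phi)
    (alphas : seq nat) (xs : seq hvar) (phis : seq hterm)
    (alphas_uniq : uniq alphas) (alphasE : alphas =i deriv_ftv d)
    (xs_uniq : uniq xs) (xsE : xs =i deriv_fv d)
    (phis_uniq : uniq phis) (phisE : phis =i G) :
  let vs := map VTy alphas ++ map VTm xs ++ map VHyp phis in
  typing (Sigma S) (ctx_of vs) (tr_deriv d (env_of vs)) (tr_prop (env_of vs) phi).
Proof.
move=> vs; rewrite env_ofE -[ctx_of vs]/((declare ([::], env0) vs).1).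
have vsE v : (v \in vs) = (v \in deriv_vars d).
  rewrite mem_deriv_vars !mem_cat mem_VTy mem_VTm mem_VHyp.
  by case: v => [a|v|psi] /=; rewrite ?orbF.
(* The declared names are closed under dependency, so goodness under [env0], which types nothing, is
   never asked for. *)
have [v|v u|wfG Hgood] := @good_declare S hS [::] env0 vs (wf_nil _) (ordered_ty_tm_hyp _ _ _).
- by rewrite vsE => /(deps_deriv_vars hS) [].
- by rewrite vsE => /(deps_deriv_vars hS) [_ sub] /sub ud; left; rewrite vsE.
by apply: typing_tr_deriv => // v vd; apply: Hgood; left; rewrite vsE.
Qed.
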